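(* As $\Delta\downarrow0$, the autocovariance at lag $p-1$ of the filtered sampled process $(\phi(B)Y_j^\Delta)_{j\in\mathbb{Z}}$ satisfies $$\gamma_{MA}(p-1)\sim(-1)^q\,\frac{\sigma^2\Delta^{2(p-q)-1}}{(2(p-q)-1)!},$$ and $\gamma_{MA}(p-1)$ is therefore non-zero for all sufficiently small $\Delta>0$.
   Context: Let $L=(L_t)_{t\in\mathbb{R}}$ be a (two-sided, real-valued) Lévy process with $E L_1=0$ and $E L_1^2=\sigma^2\in(0,\infty)$. Let $p,q$ be integers with $0\le q<p$, and let $a(z)=z^p+a_1z^{p-1}+\cdots+a_p$ and $b(z)=b_0+b_1z+\cdots+b_{p-1}z^{p-1}$ be real polynomials with $b_q=1$ and $b_j=0$ for $q<j<p$. Assume $a$ and $b$ have no common zeroes and all zeroes of $a$ have strictly negative real part. Denote the zeroes of $a$, repeated according to multiplicity, by $\lambda_1,\dots,\lambda_p$. The CARMA$(p,q)$ process $Y=(Y_t)_{t\in\mathbb{R}}$ is the strictly stationary process $$Y_t=\int_{-\infty}^\infty g(t-u)\,dL_u,\qquad g(t)=\sum_{\lambda}\mathrm{Res}_{z=\lambda}\Big(e^{zt}\frac{b(z)}{a(z)}\Big)\ (t>0),\quad g(t)=0\ (t\le 0),$$ the sum being over the distinct zeroes $\lambda$ of $a$. Equivalently, $g(t)=\mathbf b^\top e^{At}\mathbf e_p\mathbf 1_{(0,\infty)}(t)$, where $A$ is the companion matrix of $a$ (ones on the superdiagonal, last row $(-a_p,\dots,-a_1)$), $\mathbf b=(b_0,\dots,b_{p-1})^\top$,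 $\mathbf e_p=(0,\dots,0,1)^\top$. For $\Delta>0$ the sampled process is $Y^\Delta=(Y_{n\Delta})_{n\in\mathbb{Z}}$, $Y^\Delta_n=Y_{n\Delta}$; $B$ is the backward shift ($BY^\Delta_n=Y^\Delta_{n-1}$), and $\phi(B)=\prod_{j=1}^p(1-e^{\lambda_j\Delta}B)$. $\gamma_{MA}(n)$ denotes the autocovariance at lag $n$ of $(\phi(B)Y^\Delta_j)_{j\in\mathbb{Z}}$ (it depends on $\Delta$). The notation $a(\Delta)\sim b(\Delta)$ means $\lim_{\Delta\downarrow0}a(\Delta)/b(\Delta)=1$. *)

(* Defs.v *)
From HB Require Import structures.
From mathcomp Require Import all_boot all_order all_algebra complex.
From mathcomp Require Import all_classical all_reals all_analysis.

Set Implicit Arguments.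
Unset Strict Implicit.
Unset Printing Implicit Defensive.

Import Order.TTheory GRing.Theory Num.Theory.
Import numFieldNormedType.Exports.

Local Open Scope classical_set_scope.
Local Open Scope ring_scope.

Section Levy.
Context {d : measure_display} {T : measurableType d} {R : realType}.
Variable P : probability T R.

(* Taking some of the B i to be setT gives the product rule for every
   subfamily. *)
Definition mutually_independent (n : nat) (X : 'I_n -> T -> R) : Prop :=
  forall B : 'I_n -> set R, (forall i, measurable (B i)) ->
    P (\bigcap_(i in [set: 'I_n]) (X i @^-1` B i)) =
    (\prod_(i < n) P (X i @^-1` B i))%E.

Definition independent_increments (L : R -> {RV P >-> R}) : Prop :=
  forall (n : nat) (t : nat -> R), {homo t : i j / (i <= j)%N >-> i <= j} ->
    mutually_independent (fun (k : 'I_n) (w : T) => L (t k.+1) w - L (t k) w).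

Definition stationary_increments (L : R -> {RV P >-> R}) : Prop :=
  forall s t h : R, s <= t -> forall B : set R, measurable B ->
    P ((fun w => L (t + h) w - L (s + h) w) @^-1` B) =
    P ((fun w => L t w - L s w) @^-1` B).

Definition stochastically_continuous (L : R -> {RV P >-> R}) : Prop :=
  forall t eps : R, 0 < eps ->
    P [set w | eps <= `|L s w - L t w|] @[s --> t] --> 0%E.

Definition cadlag (f : R -> R) : Prop :=
  forall t : R, f s @[s --> t^'+] --> f t /\ cvg (f s @[s --> t^'-]).

(* Two-sided: the time set is the whole real line. *)
Definition levy_process (L : R -> {RV P >-> R}) : Prop :=
  [/\ {ae P, forall w, L 0 w = 0},
      independent_increments L,
      stationary_increments L,
      stochastically_continuous L &
      {ae P, forall w, cadlag (fun t => L t w)}].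

(* The triple (c, (x, y)) stands for the step function c * 1_(x, y]. *)
Definition steps := seq (R * (R * R)).

Definition wf_steps (s : steps) : bool := all (fun i => i.2.1 <= i.2.2) s.

Definition step_fun (s : steps) (u : R) : R :=
  \sum_(i <- s) i.1 * \1_(`]i.2.1, i.2.2]%classic) u.

Definition step_integral (L : R -> {RV P >-> R}) (s : steps) (w : T) : R :=
  \sum_(i <- s) i.1 * (L i.2.2 w - L i.2.1 w).

(* X is (a version of) the integral of the deterministic function f against L:
   the L^2(P)-limit of the integrals of step functions converging to f in
   L^2(du). When L_1 is centred with finite variance, the Ito isometry makes
   the limit independent, up to a P-null set, of the approximating sequence. *)
Definition is_levy_integral (L : R -> {RV P >-> R}) (f : R -> R)
    (X : {RV P >-> R}) : Prop :=
  exists s : nat -> steps,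
    [/\ forall n, wf_steps (s n),
        (\int[lebesgue_measure]_u ((f u - step_fun (s n) u) ^+ 2)%:E)%E
          @[n --> \oo] --> 0%E &
        ('E_P[fun w => ((X w - step_integral L (s n) w) ^+ 2)%R])%E
          @[n --> \oo] --> 0%E].

End Levy.

Section Carma.
Context {R : realType}.

Definition expmx (n : nat) (M : 'M[R]_n) : 'M[R]_n :=
  \matrix_(i, j) limn (series (fun k : nat => (k`!%:R^-1 *: M ^+ k) i j)).

(* The kernel g(t) = b^T exp(A t) e_p 1_(0, oo)(t), with p = deg a; for monic
   a, companionmx a has ones on the superdiagonal and last row
   (-a`_0, ..., -a`_p.-1). *)
Definition carma_kernel (a b : {poly R}) (t : R) : R :=
  let p := (size a).-1 in
  let bT : 'rV[R]_p := \row_j b`_j in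
  let ep : 'cV[R]_p := \col_i (i == p.-1 :> nat)%:R in
  if 0 < t then (bT *m expmx (t *: companionmx a) *m ep) 0 0 else 0.

Definition is_carma {d : measure_display} {T : measurableType d}
    (P : probability T R) (a b : {poly R}) (L Y : R -> {RV P >-> R}) : Prop :=
  forall t : R, is_levy_integral L (fun u => carma_kernel a b (t - u)) (Y t).

Definition expC (z : R[i]) : R[i] :=
  Complex (expR (complex.Re z) * cos (complex.Im z))
          (expR (complex.Re z) * sin (complex.Im z)).

(* The polynomial \prod_j (1 - exp(lam_j Delta) X). Its coefficients are real
   when lam lists the zeroes of a real polynomial with multiplicity (they come
   in conjugate pairs); Re only transports them from R[i] to R. *)
Definition ar_poly (p : nat) (lam : 'I_p -> R[i]) (Delta : R) : {poly R} :=
  map_poly (@complex.Re R)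
    (\prod_(j < p) (1 - (expC (lam j * Complex Delta 0)) *: 'X)).

Definition sampled {T : Type} (Y : R -> T -> R) (Delta : R) (n : int) : T -> R :=
  Y (n%:~R * Delta).

(* c(B) X, where B is the backward shift. *)
Definition lag_filter {T : Type} (c : {poly R}) (X : int -> T -> R) (n : int)
    (w : T) : R :=
  \sum_(k < size c) c`_k * X (n - k%:Z) w.

Definition gammaMA {d : measure_display} {T : measurableType d}
    (P : probability T R) (p : nat) (lam : 'I_p -> R[i]) (Y : R -> T -> R)
    (Delta : R) (j n : int) : R :=
  let Z := lag_filter (ar_poly lam Delta) (sampled Y Delta) in
  fine (covariance P (Z (j + n)) (Z j)).

End Carma.

(* Main.v *)
Require Import Defs.
From HB Require Import structures.
From mathcomp Require Import all_boot all_order all_algebra complex.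
From mathcomp Require Import all_classical all_reals all_analysis.
From mathcomp Require Import measurable_realfun.
From mathcomp Require Import zify ring lra.

Set Implicit Arguments.
Unset Strict Implicit.
Unset Printing Implicit Defensive.

Import Order.TTheory GRing.Theory Num.Theory.
Import numFieldNormedType.Exports.

Local Open Scope classical_set_scope.
Local Open Scope ring_scope.

(** Write g for the analytic extension of the kernel to the whole line, and
    Z_n = phi(B) Y_(n D) for the filtered process sampled with step D.  It is the
    integral against L of the kernel G(n D - u), where
    G(t) = sum_k phi_k g(t - k D) 1_(t - k D > 0).  By the isometry
    Cov(int f dL, int h dL) = sigma^2 int f h, the autocovariance at lag p - 1 is
    sigma^2 times the integral of G(t + (p - 1) D) G(t).

    The function g solves the homogeneous linear differential equation with
    characteristic polynomial a, and phi(B) is built to kill all its solutions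
    (lag_annihilation, ar_poly_annihilates).  Hence G is supported in [0, p D],
    and only 0 < t <= D contributes to the integral; there G(t) = g(t), and
    G(t + (p - 1) D) is the vanishing sum phi(B) g deprived of its last term, that
    is - phi_p g(t - D) (filtered_kernel_product).

    Near 0, g(t) is equivalent to t^n / n! with n = p - q - 1, because y_(p-1) is
    the first derivative of the fundamental solution that does not vanish at 0 and
    b has degree q (kernel_flat).  After the substitution t = D x, the integral is
    equivalent to D^(2n+1) times the beta integral of (x - 1)^n x^n / n!^2, which
    is (-1)^n / (2n+1)!, while phi_p tends to (-1)^p; the resulting sign is
    - (-1)^p (-1)^n = (-1)^q.

    The isometry itself rests on the variance of the increments being
    sigma^2 |t - s|.  Independence of adjacent increments makes this variance
    additive in the length of the interval, hence linear as it is nonnegative;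
    the same independence propagates square integrability from time 1 to every
    time (independent_sq_integrable).  Polarization gives the covariance of two
    arbitrary increments, bilinearity that of two step integrals, and continuity
    of the inner product under mean square convergence the general case
    (cov_levy_integral). *)

(** * The kernel as a solution of a differential equation *)

Section Egf.
Context {R : realType}.
Implicit Types (c : nat -> R) (t : R).

Definition geometrically_bounded c :=
  exists C K : R, [/\ 0 <= C, 0 <= K & forall n, `|c n| <= C * K ^+ n].

(** The exponential generating function of c.  Its derivative is the one of the
    shifted sequence, so that linear recurrences become differential equations. *)
Definition egf c t : R := limn (pseries (fun n => c n / n`!%:R) t).

Lemma geometrically_bounded_shift c :
  geometrically_bounded c -> geometrically_bounded (fun n => c n.+1).
Proof.
move=> [C [K [C0 K0 cCK]]]; exists (C * K), K; split=> // [|n].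
  exact: mulr_ge0.
by rewrite -mulrA -exprS.
Qed.

Lemma cvg_egf c t :
  geometrically_bounded c -> cvgn (pseries (fun n => c n / n`!%:R) t).
Proof.
move=> [C [K [C0 K0 cCK]]]; apply: normed_cvg.
have cvgE : cvgn (series (fun n => C * exp_coeff (K * `|t|) n)).
  apply: is_cvg_seriesZ; exact: is_cvg_series_exp_coeff.
apply: (series_le_cvg _ _ _ cvgE) => n /=; first exact: normr_ge0.
  by apply: mulr_ge0 => //; rewrite exp_coeff_ge0// mulr_ge0.
rewrite !normrM normfV normrX (ger0_norm (ler0n _ _)) exp_coeffE.
rewrite exprMn mulrAC [_^-1 * _]mulrC !mulrA ler_wpM2r ?invr_ge0//.
by rewrite ler_wpM2r// exprn_ge0.
Qed.

Lemma pseries_diffs_egf c :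
  pseries_diffs (fun n => c n / n`!%:R) = (fun n => c n.+1 / n`!%:R).
Proof.
by apply/funext => n; rewrite /pseries_diffs factS natrM invfM mulrCA mulVKf.
Qed.

Lemma is_derive_egf c t : geometrically_bounded c ->
  is_derive t 1 (egf c) (egf (fun n => c n.+1) t).
Proof.
move=> bc; have bc1 := geometrically_bounded_shift bc.
rewrite /egf -pseries_diffs_egf.
apply: (@pseries_snd_diffs _ _ (`|t| + 1)).
- exact: cvg_egf.
- by rewrite pseries_diffs_egf; exact: cvg_egf.
- rewrite !pseries_diffs_egf.
  exact: cvg_egf (geometrically_bounded_shift bc1).
- by rewrite [ltRHS]ger0_norm ?addr_ge0// ltrDl.
Qed.

Lemma egf_0 c : geometrically_bounded c -> egf c 0 = c 0%N.
Proof.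
move=> bc; apply/cvg_lim => //; rewrite -cvg_shiftS/=.
rewrite (_ : (fun n => _) = (fun=> c 0%N)); first exact: cvg_cst.
apply/funext => n; rewrite /pseries /series/= big_nat_recl// big1 => [|i _].
  by rewrite expr0 fact0 divr1 mulr1 addr0.
by rewrite expr0n/= mulr0.
Qed.

Lemma egf_sum n (k : 'I_n -> R) (c : 'I_n -> nat -> R) t :
    (forall i, geometrically_bounded (c i)) ->
  \sum_(i < n) k i * egf (c i) t = egf (fun m => \sum_(i < n) k i * c i m) t.
Proof.
move=> bc; apply/esym/cvg_lim => //.
rewrite (_ : pseries _ t =
    (fun N => \sum_(i < n) k i * pseries (fun m => c i m / m`!%:R) t N)).
  apply: cvg_big => [|i _].
    exact: add_continuous.
  by apply: cvgMr; exact: cvg_egf.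
apply/funext => N; rewrite /pseries/= /series/=.
under [RHS]eq_bigr do rewrite mulr_sumr.
rewrite exchange_big/=; apply: eq_bigr => m _.
by rewrite !mulr_suml; apply: eq_bigr => i _; rewrite !mulrA.
Qed.

End Egf.

Section Companion.
Context {R : realType}.

Lemma geometrically_bounded_expmx n (M : 'M[R]_n) i j :
  geometrically_bounded (fun k => (M ^+ k) i j).
Proof.
pose K := \sum_i \sum_j `|M i j|.
have rowK i' : \sum_j `|M i' j| <= K.
  rewrite [leRHS](bigD1 i')//= lerDl sumr_ge0// => k _.
  by rewrite sumr_ge0.
exists 1, K; split=> // [|k]; first by rewrite sumr_ge0// => ? _; rewrite sumr_ge0.
rewrite mul1r; elim: k i j => [|k IH] i j.
  by rewrite expr0 mxE; case: eqP; rewrite ?normr1 ?normr0.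
rewrite exprS mxE (le_trans (ler_norm_sum _ _ _))//.
apply: (@le_trans _ _ (\sum_l `|M i l| * K ^+ k)).
  by apply: ler_sum => l _; rewrite normrM ler_wpM2l.
rewrite -mulr_suml exprS ler_wpM2r// exprn_ge0// (le_trans _ (rowK i))//.
by rewrite sumr_ge0.
Qed.

Lemma expmxZE n (M : 'M[R]_n) (t : R) i j :
  expmx (t *: M) i j = egf (fun k => (M ^+ k) i j) t.
Proof.
rewrite mxE /egf; congr (limn (series _)); apply/funext => k.
have -> : (t *: M) ^+ k = t ^+ k *: M ^+ k.
  elim: k => [|k IH]; first by rewrite !expr0 scale1r.
  by rewrite !exprS IH -[LHS]/(_ *m _) -scalemxAl -scalemxAr scalerA.
by rewrite !mxE mulrCA mulrC [_^-1 * _]mulrC.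
Qed.

Variable a : {poly R}.
Hypotheses (ha : a \is monic) (d_gt0 : (0 < (size a).-1)%N).
Let d := (size a).-1.
Let A := companionmx a.
Let i0 : 'I_d := Ordinal d_gt0.

(** The first basis vector is cyclic for the companion matrix: multiplying it on
    the right by A runs through all the basis vectors.  Hence every entry of A^n
    in the last column is a later value of the scalar sequence formed by the
    corner entries. *)
Lemma companion_row0 (j : 'I_d) (k : 'I_d) : (A ^+ j) i0 k = (j == k)%:R.
Proof.
case: j => j jd; elim: j jd k => [|j IH] jd k.
  by rewrite expr0 mxE/= -val_eqE.
have jd' : (j < d)%N by exact: ltnW.
rewrite exprSr mxE (bigD1 (Ordinal jd'))//= (IH jd') eqxx mul1r big1 => [|l lj].
  rewrite addr0 mxE /= ltn_eqF//.
  by rewrite -ltnS prednK.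
by rewrite (IH jd') eq_sym (negbTE lj) mul0r.
Qed.

Lemma companion_row0D (j : 'I_d) n (k : 'I_d) :
  (A ^+ (n + j)) i0 k = (A ^+ n) j k.
Proof.
rewrite addnC exprD mxE (bigD1 j)//= companion_row0 eqxx mul1r big1 ?addr0//.
by move=> l lj; rewrite companion_row0 eq_sym (negbTE lj) mul0r.
Qed.

(** After d steps the cyclic vector has become the last row of A, which lists
    the opposite coefficients of a. *)
Lemma companion_recurrence n (k : 'I_d) :
  \sum_(i < d.+1) a`_i * (A ^+ (n + i)) i0 k = 0.
Proof.
rewrite big_ord_recr/= (_ : a`_d = 1) ?mul1r; last by rewrite -lead_coefE; apply/monicP.
have lt1 : (d.-1 < d)%N by rewrite ltn_predL.
have -> : (A ^+ (n + d)) i0 k = (A ^+ n.+1) (Ordinal lt1) k.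
  by rewrite -[RHS](companion_row0D (Ordinal lt1))/= addSnnS prednK.
rewrite exprS mxE -big_split big1//= => i _.
by rewrite companion_row0D mxE/= eqxx mulNr addrN.
Qed.

End Companion.

(** The matrix kernel seen as a scalar object: y 0 is the solution on the whole
    line of the differential equation with characteristic polynomial a and
    initial data (0, ..., 0, 1), y k is its k-th derivative, and the kernel is
    the differential operator b applied to y 0, cut off at the origin. *)
Lemma carma_kernelP (R : realType) (p : nat) (a b : {poly R}) :
  a \is monic -> size a = p.+1 -> (0 < p)%N ->
  exists y : nat -> R -> R,
  [/\ forall k (t : R), is_derive t (1 : R) (y k) (y k.+1 t),
      forall k t, \sum_(i < p.+1) a`_i * y (k + i)%N t = 0,
      forall k, (k < p)%N -> y k 0 = (k == p.-1)%:R &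
      forall t, carma_kernel a b t =
        if 0 < t then \sum_(i < p) b`_i * y i t else 0].
Proof.
move=> ha sa p0.
have d_gt0 : (0 < (size a).-1)%N by rewrite sa.
have il_lt : (p.-1 < (size a).-1)%N by rewrite sa/= ltn_predL.
pose il : 'I_(size a).-1 := Ordinal il_lt.
pose h n := ((companionmx a) ^+ n) (Ordinal d_gt0) il.
have bh : geometrically_bounded h by exact: geometrically_bounded_expmx.
have bhk k : geometrically_bounded (fun n => h (n + k)%N).
  elim: k => [|k IH]; first by under eq_fun do rewrite addn0.
  under eq_fun do rewrite -addSnnS.
  exact: geometrically_bounded_shift IH.
exists (fun k => egf (fun n => h (n + k)%N)); split.
- move=> k t; have := is_derive_egf t (bhk k).
  by under [in X in is_derive _ _ _ (egf X t) -> _]eq_fun do rewrite addSnnS.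
- move=> k t; rewrite egf_sum//.
  rewrite (_ : (fun m => _) = (fun=> 0)).
    rewrite /egf /pseries (_ : (fun i => _) = fun=> 0).
      apply/cvg_lim => //; rewrite (_ : series _ = fun=> 0); first exact: cvg_cst.
      by apply/funext => n; rewrite /series/= big1.
    by apply/funext => n; rewrite !mul0r.
  apply/funext => m; under eq_bigr do rewrite addnA.
  have pE : p.+1 = (size a).-1.+1 by rewrite sa.
  rewrite pE; exact: (companion_recurrence ha d_gt0 (m + k) il).
- move=> k kp; rewrite egf_0// add0n.
  have kd : (k < (size a).-1)%N by rewrite sa.
  by have := companion_row0 d_gt0 (Ordinal kd) il; rewrite -val_eqE.
- move=> t; rewrite /carma_kernel; case: ifP => // _.
  have lastE (i : 'I_(size a).-1) :
      (\col_(i < (size a).-1) (i == (size a).-1.-1 :> nat)%:R) i 0 = (i == il)%:R :> R.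
    by rewrite mxE -val_eqE/= {2}sa.
  rewrite mxE (bigD1 il)//= lastE eqxx mulr1 [X in _ + X]big1 ?addr0; last first.
    by move=> i il'; rewrite lastE (negbTE il') mulr0.
  have pE : p = (size a).-1 by rewrite sa.
  rewrite mxE [in RHS]pE; apply: eq_bigr => i _; rewrite mxE expmxZE.
  by congr (_ * egf _ t); apply/funext => n; rewrite /h companion_row0D.
Qed.

(** * The autoregressive lag polynomial annihilates the solutions *)

Section PointwiseDerivatives.
Context {R : realType}.
Implicit Types (f g : R -> R) (t : R).

Lemma is_derive_add f g t a b : is_derive t (1 : R) f a ->
  is_derive t (1 : R) g b -> is_derive t (1 : R) (fun x => f x + g x) (a + b).
Proof. by move=> df dg; exact: is_deriveD. Qed.

Lemma is_derive_mul f g t a b : is_derive t (1 : R) f a ->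
  is_derive t (1 : R) g b ->
  is_derive t (1 : R) (fun x => f x * g x) (a * g t + f t * b).
Proof.
move=> df dg; apply: (is_derive_eq (is_deriveM df dg)).
by rewrite /GRing.scale/= addrC mulrC.
Qed.

Lemma is_derive_scal (k : R) f t a : is_derive t (1 : R) f a ->
  is_derive t (1 : R) (fun x => k * f x) (k * a).
Proof. by move=> df; exact: is_deriveZ. Qed.

Lemma is_derive_affine f (k s t a : R) :
  is_derive (k * t + s) (1 : R) f a ->
  is_derive t (1 : R) (fun x => f (k * x + s)) (k * a).
Proof.
move=> df.
have dg : is_derive t (1 : R) (fun x => k * x + s) k.
  rewrite -[X in is_derive _ _ _ X]addr0; apply: is_derive_add.
  by rewrite -[X in is_derive _ _ _ X]mulr1; exact: is_derive_scal.
rewrite mulrC.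
exact: (@is_derive1_comp _ f (fun x => k * x + s) t a k).
Qed.

Lemma is_derive_shift f (s t a : R) : is_derive (t + s) (1 : R) f a ->
  is_derive t (1 : R) (fun x => f (x + s)) a.
Proof.
move=> df; have := @is_derive_affine f 1 s t a; rewrite !mul1r => /(_ df).
by under eq_fun do rewrite mul1r.
Qed.

End PointwiseDerivatives.

Section PolyAction.
Context {K : comNzRingType}.
Implicit Types (c : {poly K}) (v : nat -> K).

(** The polynomial c applied to the shift of sequences, read at index 0.  It
    covers both a differential operator, acting on the sequence of successive
    derivatives, and a lag polynomial, acting on the sequence of past values. *)
Definition poly_act c v : K := \sum_(i < size c) c`_i * v i.

Lemma poly_actE n c v : (size c <= n)%N ->
  poly_act c v = \sum_(i < n) c`_i * v i.
Proof.
move=> cn; rewrite /poly_act (big_ord_widen n (fun i => c`_i * v i))//.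
rewrite big_mkcond; apply: eq_bigr => i _; case: ltnP => // ci.
by rewrite nth_default// mul0r.
Qed.

Lemma poly_actDl c e v : poly_act (c + e) v = poly_act c v + poly_act e v.
Proof.
pose n := maxn (size c) (size e).
rewrite !(@poly_actE n) ?leq_maxl ?leq_maxr ?size_polyD// -big_split/=.
by apply: eq_bigr => i _; rewrite coefD mulrDl.
Qed.

Lemma poly_actZl k c v : poly_act (k *: c) v = k * poly_act c v.
Proof.
rewrite (@poly_actE (size c)) ?size_scale_leq// mulr_sumr.
by apply: eq_bigr => i _; rewrite coefZ mulrA.
Qed.

Lemma poly_actMX c v : poly_act (c * 'X) v = poly_act c (fun i => v i.+1).
Proof.
rewrite (@poly_actE (size c).+1); last first.
  by rewrite (leq_trans (size_polyMleq _ _))// size_polyX addn2.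
rewrite big_ord_recl coefMX mul0r add0r; apply: eq_bigr => i _.
by rewrite coefMX.
Qed.

Lemma poly_act0l v : poly_act 0 v = 0.
Proof. by rewrite /poly_act size_poly0 big_ord0. Qed.

Lemma poly_act1l v : poly_act 1 v = v 0%N.
Proof. by rewrite /poly_act size_poly1 big_ord1 coef1 mul1r. Qed.

Lemma poly_actDr c v w :
  poly_act c (fun i => v i + w i) = poly_act c v + poly_act c w.
Proof.
by rewrite /poly_act -big_split; apply: eq_bigr => i _; rewrite mulrDr.
Qed.

Lemma poly_actZr c k v : poly_act c (fun i => k * v i) = k * poly_act c v.
Proof.
by rewrite /poly_act mulr_sumr; apply: eq_bigr => i _; rewrite mulrCA.
Qed.

Lemma poly_act_mul_eq0 a c v :
    (forall k, poly_act a (fun i => v (k + i)%N) = 0) ->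
  poly_act (c * a) v = 0.
Proof.
elim/poly_ind: c v => [|c k IH] v av0; first by rewrite mul0r poly_act0l.
rewrite mulrDl mul_polyC -mulrA ['X * a]mulrC mulrA poly_actDl poly_actMX.
rewrite poly_actZl (av0 0%N) mulr0 addr0 IH// => j.
by rewrite -(av0 j.+1).
Qed.

End PolyAction.

Section ComplexValued.
Context {R : realType}.
Local Notation C := R[i].
Implicit Types (F G : R -> C) (z : C) (t : R).
Local Notation Re := (@complex.Re R).
Local Notation Im := (@complex.Im R).

(** The derivative of a complex function of a real variable, stated on the real
    and imaginary parts because the roots of a are complex while the analysis
    takes place over the real field. *)
Definition is_cderive F F' := forall t,
  is_derive t (1 : R) (fun s => Re (F s)) (Re (F' t)) /\
  is_derive t (1 : R) (fun s => Im (F s)) (Im (F' t)).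

Lemma is_cderiveD F G F' G' : is_cderive F F' -> is_cderive G G' ->
  is_cderive (fun t => F t + G t) (fun t => F' t + G' t).
Proof.
have ReD (z w : C) : Re (z + w) = Re z + Re w by case: z w => ? ? [].
have ImD (z w : C) : Im (z + w) = Im z + Im w by case: z w => ? ? [].
move=> dF dG t; rewrite ReD ImD.
under eq_fun do rewrite ReD; under [X in _ /\ is_derive _ _ X _]eq_fun do rewrite ImD.
by have [? ?] := dF t; have [? ?] := dG t; split; exact: is_derive_add.
Qed.

Lemma is_cderiveZ z F F' : is_cderive F F' ->
  is_cderive (fun t => z * F t) (fun t => z * F' t).
Proof.
have ReM (z' w : C) : Re (z' * w) = Re z' * Re w + (- Im z') * Im w.
  by case: z' w => ? ? [? ?] /=; rewrite mulNr.
have ImM (z' w : C) : Im (z' * w) = Re z' * Im w + Im z' * Re w.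
  by case: z' w => ? ? [? ?].
move=> dF t; rewrite ReM ImM.
under eq_fun do rewrite ReM; under [X in _ /\ is_derive _ _ X _]eq_fun do rewrite ImM.
by have [? ?] := dF t; split; apply: is_derive_add; exact: is_derive_scal.
Qed.

Lemma is_cderive0 : is_cderive (fun=> 0) (fun=> 0).
Proof. by move=> t; split; exact: is_derive_cst. Qed.

Lemma is_cderive_poly_act (c : {poly C}) (F F' : nat -> R -> C) :
    (forall i, is_cderive (F i) (F' i)) ->
  is_cderive (fun t => poly_act c (F ^~ t)) (fun t => poly_act c (F' ^~ t)).
Proof.
move=> dF; rewrite /poly_act.
elim: (size c) => [|n IH].
  have sum0 (G : nat -> R -> C) : (fun t => \sum_(i < 0) c`_i * G i t) = fun=> 0.
    by apply/funext => t; rewrite big_ord0.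
  by rewrite !sum0; exact: is_cderive0.
have sumS (G : nat -> R -> C) : (fun t => \sum_(i < n.+1) c`_i * G i t) =
    fun t => \sum_(i < n) c`_i * G i t + c`_n * G n t.
  by apply/funext => t; rewrite big_ord_recr.
by rewrite !sumS; apply: is_cderiveD => //; exact: is_cderiveZ.
Qed.

Lemma is_cderive_shift F F' (s : R) : is_cderive F F' ->
  is_cderive (fun t => F (t + s)) (fun t => F' (t + s)).
Proof.
move=> dF t; have [dr di] := dF (t + s).
split; first exact: (@is_derive_shift _ (fun t => Re (F t))).
exact: (@is_derive_shift _ (fun t => Im (F t))).
Qed.

(** Multiplying F by exp(- z t), with the exponential split into its modulus and
    its rotation, gives two functions G and H with zero derivative. *)
Lemma is_cderive_exp z F : is_cderive F (fun t => z * F t) ->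
  forall s t, F (s + t) = expC (z * Complex t 0) * F s.
Proof.
move=> dF s t.
pose u x := Re (F (x + s)); pose v x := Im (F (x + s)).
pose al := Re z; pose be := Im z.
have du x : is_derive x (1 : R) u (al * u x - be * v x).
  have [+ _] := is_cderive_shift s dF x.
  by rewrite /al /be /u /v; case: z {dF al be} => ? ? /=; case: (F _).
have dv x : is_derive x (1 : R) v (al * v x + be * u x).
  have [_] := is_cderive_shift s dF x.
  by rewrite /al /be /u /v; case: z {dF al be du} => ? ? /=; case: (F _).
pose E x := expR (- al * x + 0); pose Cs x := cos (be * x + 0).
pose Sn x := sin (be * x + 0).
have dE x : is_derive x (1 : R) E (- al * E x).
  by apply: is_derive_affine; exact: is_derive_expR.
have dC x : is_derive x (1 : R) Cs (be * - Sn x).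
  by apply: is_derive_affine; exact: is_derive_cos.
have dS x : is_derive x (1 : R) Sn (be * Cs x).
  by apply: is_derive_affine; exact: is_derive_sin.
pose G x := E x * (u x * Cs x + v x * Sn x).
pose H x := E x * (v x * Cs x + (- 1) * (u x * Sn x)).
have GE x y : G x = G y.
  apply: is_derive_0_is_cst => {}x.
  have d1 := is_derive_mul (du x) (dC x); have d2 := is_derive_mul (dv x) (dS x).
  by apply: (is_derive_eq (is_derive_mul (dE x) (is_derive_add d1 d2))); ring.
have HE x y : H x = H y.
  apply: is_derive_0_is_cst => {}x.
  have d1 := is_derive_mul (dv x) (dC x); have d2 := is_derive_mul (du x) (dS x).
  apply: (is_derive_eq
    (is_derive_mul (dE x) (is_derive_add d1 (is_derive_scal (- 1) d2)))).
  by ring.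
have EV x : expR (al * x) * E x = 1.
  by rewrite /E addr0 mulNr expRN divff// gt_eqF// expR_gt0.
have CS x : Cs x ^+ 2 + Sn x ^+ 2 = 1 by exact: cos2Dsin2.
have G0 : G 0 = u 0.
  by rewrite /G /E /Cs /Sn !mulr0 addr0 expR0 cos0 sin0; ring.
have H0 : H 0 = v 0.
  by rewrite /H /E /Cs /Sn !mulr0 addr0 expR0 cos0 sin0; ring.
have ReM (w : C) (x : R) : Re (w * Complex x 0) = Re w * x.
  by case: w => ? ? /=; ring.
have ImM (w : C) (x : R) : Im (w * Complex x 0) = Im w * x.
  by case: w => ? ? /=; ring.
have ut : u t = expR (al * t) * (u 0 * Cs t - v 0 * Sn t).
  rewrite -G0 -H0 (GE 0 t) (HE 0 t) -[LHS]mul1r -[in LHS](EV t).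
  by rewrite -[LHS]mulr1 -(CS t) /G /H; ring.
have vt : v t = expR (al * t) * (v 0 * Cs t + u 0 * Sn t).
  rewrite -G0 -H0 (GE 0 t) (HE 0 t) -[LHS]mul1r -[in LHS](EV t).
  by rewrite -[LHS]mulr1 -(CS t) /G /H; ring.
rewrite addrC.
have -> : F (t + s) = Complex (u t) (v t) by rewrite /u /v; case: (F _).
have -> : F s = Complex (u 0) (v 0) by rewrite /u /v add0r; case: (F _).
rewrite ut vt /Cs /Sn !addr0 /expC.
have -> : Re (z * Complex t 0) = al * t.
  by rewrite ReM; ring.
have -> : Im (z * Complex t 0) = be * t.
  by rewrite ImM; ring.
by apply/eqP; rewrite eq_complex /=; apply/andP; split; apply/eqP; ring.
Qed.

(** One root at a time.  Write F for the sequence of derivatives of a function f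
    killed by c (d - l) (d - l_1)...(d - l_r), with d the derivative.  By
    induction the product of the factors 1 - exp(l_i Delta) B kills
    c (d - l) f; this product commutes with d, so it sends c f to a solution K of
    K' = l K.  Such a K is a multiple of exp(l t), and the remaining factor
    1 - exp(l Delta) B kills it. *)
Lemma lag_annihilation (Delta : R) (s : seq C) (F : nat -> R -> C)
    (c : {poly C}) :
    (forall i, is_cderive (F i) (F i.+1)) ->
    (forall t, poly_act (c * \prod_(l <- s) ('X - l%:P)) (F ^~ t) = 0) ->
  forall t, poly_act
    (\prod_(l <- s) (1 - expC (l * Complex Delta 0) *: 'X))
    (fun k => poly_act c (F ^~ (t - k%:R * Delta))) = 0.
Proof.
move=> dF; elim: s c => [|l s IH] c cF0 t.
  by rewrite big_nil poly_act1l -[RHS](cF0 t) big_nil mulr1 mul0r subr0.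
pose phi := \prod_(m <- s) (1 - expC (m * Complex Delta 0) *: 'X).
rewrite big_cons -/phi.
pose K t := poly_act phi (fun k => poly_act c (F ^~ (t - k%:R * Delta))).
have dK : is_cderive K (fun t => l * K t).
  move/(_ (c * ('X - l%:P))) in IH.
  rewrite (_ : (fun t => l * K t) = (fun t => poly_act phi
      (fun k => poly_act c (fun i => F i.+1 (t - k%:R * Delta))))).
    rewrite /K.
    apply: (@is_cderive_poly_act phi
      (fun k t => poly_act c (F ^~ (t - k%:R * Delta)))
      (fun k t => poly_act c (fun i => F i.+1 (t - k%:R * Delta)))) => k.
    apply: (@is_cderive_shift (fun t => poly_act c (F ^~ t))
      (fun t => poly_act c (fun i => F i.+1 t))).
    by apply: (@is_cderive_poly_act c F (fun i => F i.+1)).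
  apply/funext => x; apply/esym/eqP; rewrite -subr_eq0 /K -poly_actZr.
  rewrite -mulN1r -poly_actZr -poly_actDr; apply/eqP.
  rewrite -[RHS](IH _ x); last by move=> y; rewrite -mulrA -(cF0 y) big_cons.
  congr (poly_act phi _); apply/funext => k.
  have -> : c * ('X - l%:P) = c * 'X + (- l) *: c.
    by rewrite mulrBr scaleNr -mul_polyC [c * l%:P]mulrC.
  by rewrite poly_actDl poly_actMX poly_actZl mulN1r mulNr.
have := is_cderive_exp dK (t - Delta) Delta; rewrite subrK => KE.
have -> (e : C) : (1 - e *: 'X) * phi = phi + (- e) *: (phi * 'X).
  by rewrite mulrBl mul1r -scalerAl ['X * phi]mulrC scaleNr.
rewrite poly_actDl poly_actZl -/(K t) KE poly_actMX.
rewrite (_ : poly_act phi _ = K (t - Delta)) ?mulNr ?subrr//.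
congr (poly_act phi _); apply/funext => k.
by rewrite (_ : t - k.+1%:R * Delta = t - Delta - k%:R * Delta)// -nat1r; ring.
Qed.

End ComplexValued.

(** The solution is real-valued, so that taking real parts in the complex
    identity replaces each coefficient by its real part. *)
Lemma ar_poly_annihilates (R : realType) (p : nat) (a b : {poly R})
    (lam : 'I_p -> R[i]) (y : nat -> R -> R) (Delta : R) :
    map_poly (real_complex R) a = \prod_(j < p) ('X - (lam j)%:P) ->
    (forall k (t : R), is_derive t (1 : R) (y k) (y k.+1 t)) ->
    (forall k t, poly_act a (fun i => y (k + i)%N t) = 0) ->
  forall t, poly_act (ar_poly lam Delta)
    (fun k => poly_act b (y ^~ (t - k%:R * Delta))) = 0.
Proof.
move=> hlam dy ay0 t.
pose F k t := real_complex R (y k t).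
have mapE (c : {poly R}) (v : nat -> R) :
    poly_act (map_poly (real_complex R) c) (fun i => real_complex R (v i)) =
    real_complex R (poly_act c v).
  rewrite (@poly_actE _ (size c)) ?size_poly// /poly_act rmorph_sum.
  by apply: eq_bigr => i _; rewrite coef_map rmorphM.
pose phi := \prod_(l <- [seq lam j | j <- enum 'I_p])
  (1 - expC (l * Complex Delta 0) *: 'X).
have := @lag_annihilation R Delta [seq lam j | j <- enum 'I_p] F
  (map_poly (real_complex R) b).
rewrite -/phi => /(_ _ _ t) phi0.
have {}phi0 : poly_act phi (fun k =>
    real_complex R (poly_act b (y ^~ (t - k%:R * Delta)))) = 0.
  rewrite -phi0.
  - by congr (poly_act phi _); apply/funext => k; rewrite -mapE.
  - by move=> i x; split; rewrite /F/=; [exact: dy|exact: is_derive_cst].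
  - move=> x; rewrite big_map enumT -hlam.
    apply: poly_act_mul_eq0 => k.
    by rewrite (mapE a (fun i => y (k + i)%N x)) ay0.
have arE : ar_poly lam Delta = map_poly (@complex.Re R) phi.
  by rewrite /ar_poly /phi big_map enumT.
rewrite arE -[RHS]/(complex.Re (0 : R[i])) -phi0.
rewrite (@poly_actE _ (size phi)) ?size_poly// /poly_act.
have ReD : {morph (@complex.Re R) : u v / u + v} by move=> [? ?] [? ?].
rewrite (big_morph _ ReD (erefl : complex.Re (0 : R[i]) = 0)).
apply: eq_bigr => i _; rewrite coef_map_id0//.
by case: (phi`_i) => u v /=; rewrite mulr0 subr0.
Qed.

(** * Behaviour of the kernel near the origin *)

Section SmallTime.
Context {R : realType}.

Lemma is_derive_monomial n (t : R) :
  is_derive t (1 : R) (fun x => x ^+ n.+1 / n.+1`!%:R) (t ^+ n / n`!%:R).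
Proof.
have d : is_derive t (1 : R) (fun x : R => x ^+ n.+1) (n.+1%:R * t ^+ n).
  have := @is_deriveX R R (@id R) n.+1 t 1 1 (is_derive_id _ _).
  by rewrite exprfctE /GRing.scale/= mulr1.
have -> : (fun x : R => x ^+ n.+1 / n.+1`!%:R) = fun x => n.+1`!%:R^-1 * x ^+ n.+1.
  by apply/funext => x; rewrite mulrC.
apply: (is_derive_eq (is_derive_scal _ d)).
by rewrite factS natrM invfM mulrACA mulVf// mul1r mulrC.
Qed.

Lemma mvt_from0 (h dh : R -> R) (t : R) :
    (forall x, is_derive x (1 : R) h (dh x)) ->
  exists2 c, `|c| <= `|t| & h t - h 0 = dh c * t.
Proof.
move=> dH; have ch (A : set R) : {within A, continuous h}.
  apply: continuous_subspaceT => x.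
  exact/differentiable_continuous/derivable1_diffP.
have [t0|t0] := leP 0 t.
  have [c] := MVT_segment t0 (fun x _ => dH x) (ch _).
  rewrite in_itv/= subr0 => /andP[c0 ct] ->; exists c => //.
  by rewrite !ger0_norm// (le_trans c0).
have [c] := MVT_segment (ltW t0) (fun x _ => dH x) (ch _).
rewrite in_itv/= sub0r mulrN => /andP[tc c0] /eqP; rewrite -eqr_oppLR opprB.
move=> /eqP ->; exists c => //.
by rewrite !ler0_norm// ?lerN2// ltW.
Qed.

(** A Taylor expansion with remainder o(t^n), two-sided in t since both g(t) and
    g(t - D) occur in the integral.  The remainder for f 0 is obtained from that
    for f 1 by the mean value theorem, down to the continuity of f n at 0. *)
Lemma flat_expansion n (f : nat -> R -> R) :
    (forall k t, is_derive t (1 : R) (f k) (f k.+1 t)) ->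
    (forall k, (k < n)%N -> f k 0 = 0) -> f n 0 = 1 ->
  forall e : R, 0 < e -> exists2 r : R, 0 < r &
    forall t, `|t| < r -> `|f 0%N t - t ^+ n / n`!%:R| <= e * `|t| ^+ n.
Proof.
elim: n f => [|n IH] f df f0 fn1 e e0.
  have cf : {for 0, continuous (f 0%N)}.
    exact/differentiable_continuous/derivable1_diffP.
  move/cvgrPdist_le : cf => /(_ _ e0) /nbhs_ballP[r/= r0 fr].
  exists r => // t tr; rewrite !expr0 fact0 divr1 mulr1 -fn1 distrC.
  by apply: fr; rewrite /ball/= sub0r normrN.
have [r r0 fr] := IH (fun k => f k.+1) (fun k => df k.+1)
  (fun k kn => f0 k.+1 kn) fn1 e e0.
exists r => // t tr.
have dH x : is_derive x (1 : R) (fun x => f 0%N x + (-1) * (x ^+ n.+1 / n.+1`!%:R))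
    (f 1%N x + (-1) * (x ^+ n / n`!%:R)).
  by apply: is_derive_add => //; apply: is_derive_scal; exact: is_derive_monomial.
have [c ct] := mvt_from0 t dH.
rewrite f0// expr0n/= mul0r mulr0 addr0 subr0 !mulN1r => ->.
rewrite normrM exprSr mulrA ler_wpM2r//.
rewrite (le_trans (fr _ (le_lt_trans ct tr)))// ler_wpM2l ?(ltW e0)//.
by rewrite lerXn2r ?nnegrE.
Qed.

(** The substitution u = c - D x. *)
Lemma Rintegral_rescale (h : R -> R) (c D : R) : 0 < D -> continuous h ->
  (\int[lebesgue_measure]_(u in `[c - D, c]) h (c - u) =
   D * \int[lebesgue_measure]_(x in `[0, 1]) h (D * x))%R.
Proof.
move=> D0 ch.
pose F x : R := - D * x + c.
have dF x : is_derive x (1 : R) F (- D).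
  rewrite -[X in is_derive _ _ _ X]addr0; apply: is_derive_add.
  by rewrite -[X in is_derive _ _ _ X]mulr1; exact: is_derive_scal.
have F'E : (F^`())%classic = cst (- D).
  by apply/funext => x; rewrite derive1E derive_val.
have cF : continuous F.
  by move=> x; exact/differentiable_continuous/derivable1_diffP.
have chD : continuous (fun x => h (D * x)).
  by move=> x; apply: continuous_comp; [exact: mulrl_continuous|exact: ch].
have int_hD : lebesgue_measure.-integrable `[0, 1] (EFin \o (fun x => h (D * x))).
  by apply: continuous_compact_integrable;
    [exact: segment_compact|exact: continuous_subspaceT].
rewrite -RintegralZl// /Rintegral; congr fine.
have F0 : F 0 = c by rewrite /F mulr0 add0r.
have F1 : F 1 = c - D by rewrite /F mulr1 addrC.
rewrite -[X in `[_, X]]F0 -F1.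
rewrite (@integration_by_substitution_decreasing _ F (fun u => h (c - u)) 0 1)//.
- apply: eq_integral => x _; congr EFin.
  by rewrite /= F'E /= fctE /= /F opprK mulrC; congr (_ * h _); ring.
- by move=> x y _ _ xy; rewrite /F ltrD2r ltr_nM2l// oppr_lt0.
- by rewrite F'E => x _; exact: cst_continuous.
- by rewrite F'E; exact: is_cvg_cst.
- by rewrite F'E; exact: is_cvg_cst.
- split=> //.
  + exact/cvg_at_right_filter/cF.
  + exact/cvg_at_left_filter/cF.
- apply: continuous_subspaceT => x; apply: continuous_comp; last exact: ch.
  by apply: cvgB; [exact: cvg_cst|exact: cvg_id].
Qed.

Lemma beta_integral n :
  (\int[@lebesgue_measure R]_(x in `[0, 1])
     (((x - 1) ^+ n / n`!%:R) * (x ^+ n / n`!%:R)) =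
   (-1) ^+ n / (n.*2.+1)`!%:R)%R.
Proof.
have -> : (fun x : R => ((x - 1) ^+ n / n`!%:R) * (x ^+ n / n`!%:R)) =
    (fun x => ((-1) ^+ n / (n`!%:R * n`!%:R)) * XMonemX n n x).
  apply/funext => x; rewrite -[XMonemX n n x]/(x ^+ n * (1 - x) ^+ n) -[x - 1]opprB.
  by rewrite -[- (1 - x)]mulN1r exprMn invfM; ring.
rewrite RintegralZl//; last exact: integrable_XMonemX.
have -> : (\int[@lebesgue_measure R]_(x in `[0, 1]) XMonemX n n x)%R =
    beta_fun n.+1 n.+1.
  by rewrite /beta_fun Rintegral_mkcond.
rewrite beta_fun_fact natrM addnn.
have n0 : n`!%:R != 0 :> R by rewrite pnatr_eq0 -lt0n fact_gt0.
by field; rewrite n0 pnatr_eq0 -lt0n fact_gt0.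
Qed.

Lemma Rintegral_01_cst (e : R) :
  (\int[lebesgue_measure]_(x in `[0%R, 1%R]) e)%R = e.
Proof.
by rewrite Rintegral_cst//= lebesgue_measure_itv/= lte01 oppr0 adde0/= mulr1.
Qed.

(** After the rescaling, g (D x - D) / D^n and g (D x) / D^n converge uniformly
    on [0, 1] to the monomials whose product is integrated in beta_integral. *)
Lemma rescaled_product_cvg n (g : R -> R) : continuous g ->
    (forall e : R, 0 < e -> exists2 r : R, 0 < r &
      forall t, `|t| < r -> `|g t - t ^+ n / n`!%:R| <= e * `|t| ^+ n) ->
  (\int[lebesgue_measure]_(x in `[0, 1]) (g (D * x - D) * g (D * x)))%R
     / D ^+ n.*2 @[D --> 0^'+] --> ((-1) ^+ n / (n.*2.+1)`!%:R : R).
Proof.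
move=> cg exp_g; apply/cvgrPdist_le => e e0.
(* If both factors are within e1 <= 1 of limits bounded by 1, their products
   differ by at most e1 (e1 + 2) <= 3 e1. *)
pose e1 := Num.min 1 (e / 3).
have e10 : 0 < e1 by rewrite lt_min ltr01 divr_gt0.
have [r r0 gr] := exp_g _ e10.
near=> D.
have D0 : 0 < D by near: D; exact: nbhs_right_gt.
have Dr : D < r by near: D; exact: nbhs_right_lt.
have aux (s : R) : `|s| <= 1 -> `|g (D * s) / D ^+ n - s ^+ n / n`!%:R| <= e1.
  move=> s1; have := gr (D * s); rewrite normrM (gtr0_norm D0).
  have -> : D * `|s| < r by rewrite (le_lt_trans _ Dr)// ger_pMr.
  move=> /(_ isT); rewrite !exprMn => H.
  have Dn0 : 0 < D ^+ n by rewrite exprn_gt0.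
  have -> : g (D * s) / D ^+ n - s ^+ n / n`!%:R =
      (g (D * s) - D ^+ n * s ^+ n / n`!%:R) / D ^+ n.
    by rewrite mulrBl -[D ^+ n * _ / _]mulrA [D ^+ n * _]mulrC mulfK ?gt_eqF.
  rewrite normrM normfV (gtr0_norm Dn0) ler_pdivrMr// (le_trans H)//.
  rewrite ler_wpM2l ?(ltW e10)// ler_piMr ?(ltW Dn0)//.
  by rewrite exprn_ile1.
have mon1 (s : R) : `|s| <= 1 -> `|s ^+ n / n`!%:R| <= 1.
  move=> s1; rewrite normrM normrX normfV (ger0_norm (ler0n _ _)).
  apply: mulr_ile1; rewrite ?invr_ge0 ?ler0n ?exprn_ge0 ?exprn_ile1//.
  by rewrite invf_le1 ?ltr0n ?fact_gt0// ler1n fact_gt0.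
rewrite -beta_integral.
have ccont (f : R -> R) : continuous f ->
    lebesgue_measure.-integrable `[0, 1] (EFin \o f).
  by move=> cf; apply: continuous_compact_integrable;
    [exact: segment_compact|exact: continuous_subspaceT].
have cDx : continuous (fun x : R => D * x) by exact: mulrl_continuous.
have cgD : continuous (fun x => g (D * x)).
  by move=> x; apply: continuous_comp; [exact: cDx|exact: cg].
have cgDD : continuous (fun x => g (D * x - D)).
  move=> x; apply: continuous_comp; last exact: cg.
  by apply: cvgB; [exact: cDx|exact: cvg_cst].
have cgg : continuous (fun x => g (D * x - D) * g (D * x)).
  by move=> x; apply: cvgM; [exact: cgDD|exact: cgD].
have cX : continuous (fun x : R => x ^+ n / n`!%:R).
  by move=> x; apply: cvgM; [exact: exprn_continuous|exact: cvg_cst].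
have cX1 : continuous (fun x : R => (x - 1) ^+ n / n`!%:R).
  move=> x; apply: (@continuous_comp _ _ _ (fun x : R => x - 1)
    (fun x => x ^+ n / n`!%:R)).
    by apply: cvgB; [exact: cvg_id|exact: cvg_cst].
  exact: cX.
have cXX : continuous (fun x : R => ((x - 1) ^+ n / n`!%:R) * (x ^+ n / n`!%:R)).
  by move=> x; apply: cvgM; [exact: cX1|exact: cX].
rewrite -RintegralZr//; last exact: ccont.
rewrite -RintegralB//; [|exact: ccont|]; last first.
  apply: ccont => x; apply: (cvgM (cgg x)); exact: cvg_cst.
have cdiff : continuous (fun x : R => (x - 1) ^+ n / n`!%:R * (x ^+ n / n`!%:R) -
    g (D * x - D) * g (D * x) / D ^+ n.*2).
  move=> x; apply: cvgB; first exact: cXX.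
  apply: (cvgM (cgg x)); exact: cvg_cst.
apply: (le_trans (le_normr_Rintegral _ (ccont _ cdiff))) => //.
apply: (@le_trans _ _ (\int[lebesgue_measure]_(x in `[0%R, 1%R]) e)%R).
  apply: le_Rintegral => //.
  - by apply: ccont => x; apply: cvg_norm; exact: cdiff.
  - by apply: ccont => x; exact: cvg_cst.
  move=> x /=; rewrite in_itv/= => /andP[x0 x1].
  have nx : `|x| <= 1 by rewrite ger0_norm.
  have nx1 : `|x - 1| <= 1 by rewrite ler0_norm ?subr_le0// opprB gerBl.
  have Hx := aux _ nx; have Hx1 := aux _ nx1.
  rewrite mulrBr mulr1 in Hx1.
  have Mx := mon1 _ nx; have Mx1 := mon1 _ nx1.
  rewrite -addnn exprD.
  set A := g (D * x - D) in Hx1 *; set B := g (D * x) in Hx *.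
  set a1 := _ / n`!%:R in Hx1 Mx1 *; set b1 := x ^+ n / _ in Hx Mx *; clearbody a1 b1.
  have -> : a1 * b1 - A * B / (D ^+ n * D ^+ n) =
     - ((A / D ^+ n - a1) * (B / D ^+ n - b1) + (A / D ^+ n - a1) * b1
        + a1 * (B / D ^+ n - b1)).
    by field; rewrite expf_neq0// gt_eqF.
  rewrite normrN.
  have e11 : e1 <= 1 by rewrite ge_min lexx.
  have e1e : 3 * e1 <= e by rewrite mulrC -ler_pdivlMr// ge_min lexx orbT.
  apply: le_trans (ler_normD _ _) _; rewrite normrM.
  apply: (@le_trans _ _ ((e1 + e1) + e1)); last by rewrite (le_trans _ e1e)//; lra.
  apply: lerD; last by rewrite -[e1]mul1r ler_pM.
  apply: le_trans (ler_normD _ _) _; rewrite !normrM.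
  apply: lerD; rewrite -[leRHS]mulr1 ler_pM//.
  exact: le_trans Hx e11.
by rewrite Rintegral_01_cst.
Unshelve. all: by end_near. Qed.

End SmallTime.

(** * The filtered kernel *)

Section ProductOfLinearFactors.
Context {K : comNzRingType}.
Implicit Types s : seq K.
Local Notation prodl s := (\prod_(e <- s) (1 - e *: 'X)).

Lemma prod_linear_cons_coef e s i :
  (prodl (e :: s))`_i = (prodl s)`_i - e * (if i is j.+1 then (prodl s)`_j else 0).
Proof.
rewrite big_cons mulrBl mul1r -scalerAl ['X * _]mulrC coefB coefZ coefMX.
by case: i.
Qed.

Lemma coef0_prod_linear s : (prodl s)`_0 = 1.
Proof.
elim: s => [|e s IH]; first by rewrite big_nil coef1.
by rewrite prod_linear_cons_coef IH mulr0 subr0.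
Qed.

Lemma size_prod_linear s : (size (prodl s) <= (size s).+1)%N.
Proof.
elim: s => [|e s IH]; first by rewrite big_nil size_poly1.
apply/leq_sizeP => i; rewrite prod_linear_cons_coef.
case: i => // i; rewrite ltnS => si.
by rewrite !(leq_sizeP _ _ IH) ?mulr0 ?subr0// (leq_trans si).
Qed.

Lemma coef_size_prod_linear s : (prodl s)`_(size s) = \prod_(e <- s) (- e).
Proof.
elim: s => [|e s IH]; first by rewrite !big_nil coef1.
rewrite prod_linear_cons_coef/= IH (leq_sizeP _ _ (size_prod_linear s))//.
by rewrite big_cons sub0r mulNr.
Qed.

End ProductOfLinearFactors.

Section ArPoly.
Context {R : realType} (p : nat) (lam : 'I_p -> R[i]).

Lemma ar_polyE (Delta : R) : ar_poly lam Delta =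
  map_poly (@complex.Re R)
   (\prod_(e <- [seq expC (lam j * Complex Delta 0) | j <- enum 'I_p]) (1 - e *: 'X)).
Proof. by rewrite /ar_poly big_map enumT. Qed.

Lemma size_ar_poly Delta : (size (ar_poly lam Delta) <= p.+1)%N.
Proof.
rewrite ar_polyE (leq_trans (size_poly _ _))// (leq_trans (size_prod_linear _))//.
by rewrite size_map size_enum_ord.
Qed.

Lemma ar_poly_coef0 Delta : (ar_poly lam Delta)`_0 = 1.
Proof. by rewrite ar_polyE coef_map_id0// coef0_prod_linear. Qed.

(** Each exp(lam_j Delta) tends to 1, and the top coefficient is the product of
    the - exp(lam_j Delta). *)
Lemma ar_poly_coef_cvg :
  (ar_poly lam Delta)`_p @[Delta --> 0^'+] --> ((-1) ^+ p : R).
Proof.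
pose F (s : seq 'I_p) (D : R) := \prod_(j <- s) (- expC (lam j * Complex D 0)).
have cF s : complex.Re (F s D) @[D --> 0^'+] --> ((-1) ^+ size s : R) /\
            complex.Im (F s D) @[D --> 0^'+] --> (0 : R).
  elim: s => [|j s [IHr IHi]].
    by rewrite /F; under eq_fun do rewrite big_nil;
      under [X in _ /\ X @ _ --> _]eq_fun do rewrite big_nil; split; exact: cvg_cst.
  pose al := complex.Re (lam j); pose be := complex.Im (lam j).
  have cl (k : R) : k * D @[D --> 0^'+] --> (0 : R).
    rewrite -[X in _ --> X](mulr0 k); apply: cvgMr; exact: cvg_at_right_filter.
  have ce : expR (al * D) @[D --> 0^'+] --> (1 : R).
    by rewrite -expR0; apply: continuous_cvg; [exact: continuous_expR|exact: cl].
  have cc : cos (be * D) @[D --> 0^'+] --> (1 : R).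
    by rewrite -cos0; apply: continuous_cvg; [exact: continuous_cos|exact: cl].
  have cs : sin (be * D) @[D --> 0^'+] --> (0 : R).
    rewrite -[X in _ --> X]sin0; apply: continuous_cvg; last exact: cl.
    exact: continuous_sin.
  have ReE D : complex.Re (F (j :: s) D) =
     - (expR (al * D) * cos (be * D)) * complex.Re (F s D) +
      (expR (al * D) * sin (be * D)) * complex.Im (F s D).
    rewrite /F big_cons -/(F s D) /al /be; case: (lam j) => u v.
    by case: (F s D) => x y /=; rewrite !mulr0 !subr0 add0r; ring.
  have ImE D : complex.Im (F (j :: s) D) =
     - (expR (al * D) * cos (be * D)) * complex.Im (F s D) +
      - (expR (al * D) * sin (be * D)) * complex.Re (F s D).
    rewrite /F big_cons -/(F s D) /al /be; case: (lam j) => u v.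
    by case: (F s D) => x y /=; rewrite !mulr0 !subr0 add0r; ring.
  have lR : - (1 * 1) * (-1) ^+ size s + 1 * 0 * 0 = (-1) ^+ size (j :: s) :> R.
    by rewrite /= exprS; ring.
  have lI : - (1 * 1) * 0 + - (1 * 0) * (-1) ^+ size s = 0 :> R by ring.
  rewrite (funext ReE) (funext ImE) -lR -[X in _ /\ _ --> X]lI; split.
    exact: (cvgD (cvgM (cvgN (cvgM ce cc)) IHr) (cvgM (cvgM ce cs) IHi)).
  exact: (cvgD (cvgM (cvgN (cvgM ce cc)) IHi) (cvgM (cvgN (cvgM ce cs)) IHr)).
have [+ _] := cF (enum 'I_p); rewrite size_enum_ord; apply: cvg_trans.
apply: near_eq_cvg; near=> D.
rewrite ar_polyE coef_map_id0//; set s := [seq _ | _ <- _].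
have sp : size s = p by rewrite size_map size_enum_ord.
by have := coef_size_prod_linear s; rewrite sp => ->; rewrite big_map.
Unshelve. all: by end_near. Qed.

End ArPoly.

Section FilteredKernel.
Context {R : realType}.
Variables (phi : {poly R}) (g : R -> R) (p : nat) (D : R).
Hypotheses (p0 : (0 < p)%N) (D0 : 0 < D) (sphi : (size phi <= p.+1)%N).
Hypothesis phi0 : phi`_0 = 1.
Hypothesis kill : forall t, poly_act phi (fun k => g (t - k%:R * D)) = 0.
Let kern t : R := if 0 < t then g t else 0.
Let G t := poly_act phi (fun k => kern (t - k%:R * D)).

(** The filtered kernel G is supported in [0, p D]: beyond p D all cut-offs are
    inactive and phi kills g.  So a shift by p - 1 steps leaves an overlap of one
    step.  There the earlier factor has only its term of index 0, while the later
    factor misses only its term of index p and is minus that term. *)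
Lemma filtered_kernel_product t : G (t + p.-1%:R * D) * G t =
  if 0 < t <= D then - phi`_p * (g (t - D) * g t) else 0.
Proof.
have [t0|t0] /= := ltP 0 t; last first.
  rewrite [X in _ * X](_ : G t = 0) ?mulr0// /G /poly_act big1// => k _.
  rewrite /kern ltNge (_ : t - k%:R * D <= 0) ?mulr0//.
  by rewrite subr_le0 (le_trans t0)// mulr_ge0// ltW.
have [tD|tD] := leP t D; last first.
  rewrite (_ : G (_ + _) = 0) ?mul0r// -[RHS](kill (t + p.-1%:R * D)).
  rewrite /G !(@poly_actE _ p.+1)//; apply: eq_bigr => k _; congr (_ * _).
  rewrite /kern ifT// subr_gt0.
  have kp : (k%:R : R) <= p.-1%:R + 1 by rewrite natr1 ler_nat prednK// -ltnS.
  rewrite (le_lt_trans (ler_wpM2r (ltW D0) kp))// mulrDl mul1r addrC.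
  by rewrite ltrD2r.
have -> : G t = g t.
  rewrite /G (@poly_actE _ p.+1)// big_ord_recl phi0 mul1r mul0r subr0 big1 => [|k _].
    by rewrite addr0 /kern t0.
  rewrite /kern ifF ?mulr0//; apply/negbTE; rewrite -leNgt subr_le0 (le_trans tD)//.
  by rewrite ler_peMl// ?(ltW D0)// lift0 ler1n.
have pE : (t + p.-1%:R * D - p%:R * D) = t - D.
  rewrite -[in X in _ - X](prednK p0) -natr1; ring.
rewrite mulrA; congr (_ * _).
have := kill (t + p.-1%:R * D).
rewrite /G !(@poly_actE _ p.+1)// !big_ord_recr/= pE.
move/eqP; rewrite addr_eq0 => /eqP E.
rewrite {2}/kern ifF; last by apply/negbTE; rewrite -leNgt subr_le0.
rewrite mulr0 addr0 mulNr -E; apply: eq_bigr => k _; congr (_ * _).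
rewrite /kern ifT// subr_gt0.
have kp : (k%:R : R) <= p.-1%:R by rewrite ler_nat -ltnS prednK.
by rewrite (le_lt_trans (ler_wpM2r (ltW D0) kp))// ltrDr.
Qed.

Lemma Rintegral_filtered_kernel (cg : continuous g) (s : R) :
  (\int[lebesgue_measure]_u (G (s + p.-1%:R * D - u) * G (s - u)) =
   - phi`_p * (D * \int[lebesgue_measure]_(x in `[0, 1])
     (g (D * x - D) * g (D * x))))%R.
Proof.
have cgD : continuous (fun x => g (x - D)).
  move=> x; apply: (@continuous_comp _ _ _ (fun x : R => x - D) g); last exact: cg.
  by apply: cvgB; [exact: cvg_id|exact: cvg_cst].
have cgg : continuous (fun x => g (x - D) * g x).
  by move=> x; apply: cvgM; [exact: cgD|exact: cg].
have cggs : continuous (fun u => g (s - u - D) * g (s - u)).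
  move=> x; apply: (@continuous_comp _ _ _ (fun u : R => s - u)
    (fun x => g (x - D) * g x)); last exact: cgg.
  by apply: cvgB; [exact: cvg_cst|exact: cvg_id].
have icc (f : R -> R) : continuous f ->
    lebesgue_measure.-integrable `[s - D, s] (EFin \o f).
  move=> cf; apply: continuous_compact_integrable; first exact: segment_compact.
  exact: continuous_subspaceT.
rewrite -(@Rintegral_rescale _ (fun x => g (x - D) * g x) s D)//.
rewrite -RintegralZl//; last exact: icc.
rewrite -Rintegral_itv_bndo_bndc; last first.
  have cc : continuous (fun u => - phi`_p * (g (s - u - D) * g (s - u))).
    by move=> x; apply: cvgM; [exact: cvg_cst|exact: cggs].
  apply: (integrableS _ _ _ (icc _ cc)) => //.
  by apply: subset_itvl; rewrite bnd_simp.
rewrite [RHS]Rintegral_mkcond; apply: eq_Rintegral => u _.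
rewrite [s + _ - u]addrAC filtered_kernel_product patchE/=.
rewrite mem_setE in_itv/= subr_gt0 lerBlDr -lerBlDl andbC.
by [].
Qed.

End FilteredKernel.

(** * Square integrable functions *)

Section SquareIntegrable.
Context d (T : measurableType d) (R : realType) (mu : {measure set T -> \bar R}).
Implicit Types f g : T -> R.

(** Square integrability and the inner product are kept general in the measure,
    since they serve both for the probability and for the Lebesgue measure. *)
Definition sq_integrable f := measurable_fun [set: T] f /\
  mu.-integrable [set: T] (EFin \o (fun x => f x ^+ 2)).

Definition inner f g : R := (\int[mu]_x (f x * g x))%R.

Lemma sq_integrableP f : measurable_fun [set: T] f ->
  (\int[mu]_x ((f x ^+ 2)%:E) < +oo)%E -> sq_integrable f.
Proof.
move=> mf foo; split=> //; apply/integrableP; split.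
  by apply/measurable_EFinP; exact: measurable_funX.
apply: le_lt_trans foo; rewrite le_eqVlt; apply/orP; left; apply/eqP.
by apply: eq_integral => x _; rewrite /= ger0_norm// sqr_ge0.
Qed.

Lemma sq_integrable_le f g h : measurable_fun [set: T] f ->
  sq_integrable g -> sq_integrable h ->
  (forall x, f x ^+ 2 <= g x ^+ 2 + h x ^+ 2) -> sq_integrable f.
Proof.
move=> mf [mg ig] [mh ih] fgh; split => //.
apply: (@le_integrable _ _ _ _ _ measurableT _
    (EFin \o (fun x => g x ^+ 2 + h x ^+ 2))).
- by apply/measurable_EFinP; exact: measurable_funX.
- move=> x _ /=; rewrite lee_fin !ger0_norm ?addr_ge0 ?sqr_ge0//.
- exact: (integrableD measurableT ig ih).
Qed.

Lemma sq_integrableZ a f : sq_integrable f -> sq_integrable (fun x => a * f x).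
Proof.
move=> [mf fi]; split; first exact: measurable_funM.
have := integrableZl measurableT (a ^+ 2) fi; apply: eq_integrable => // x _ /=.
by rewrite -EFinM exprMn.
Qed.

Lemma sq_integrableD f g :
  sq_integrable f -> sq_integrable g -> sq_integrable (fun x => f x + g x).
Proof.
move=> sf sg; apply: (@sq_integrable_le _ (fun x => 2 * f x) (fun x => 2 * g x)).
- by case: sf sg => [mf _] [mg _]; exact: measurable_funD.
- exact: sq_integrableZ.
- exact: sq_integrableZ.
- move=> x; have := sqr_ge0 (f x - g x); have := sqr_ge0 (f x + g x).
  rewrite !exprMn sqrrB sqrrD; lra.
Qed.

Lemma sq_integrableB f g :
  sq_integrable f -> sq_integrable g -> sq_integrable (fun x => f x - g x).
Proof.
move=> sf sg; have := sq_integrableD sf (sq_integrableZ (- 1) sg).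
by under eq_fun do rewrite mulN1r.
Qed.

Lemma sq_integrable0 : sq_integrable (fun=> 0).
Proof.
apply: sq_integrableP => //.
by rewrite (eq_integral (cst 0%E)) ?integral0// => x _; rewrite /= expr0n.
Qed.

Lemma sq_integrable_sum I (s : seq I) (F : I -> T -> R) :
  (forall i, sq_integrable (F i)) -> sq_integrable (fun x => \sum_(i <- s) F i x).
Proof.
move=> sF; elim: s => [|i s IH].
  by under eq_fun do rewrite big_nil; exact: sq_integrable0.
by under eq_fun do rewrite big_cons; exact: sq_integrableD.
Qed.

Lemma integrable_mul f g : sq_integrable f -> sq_integrable g ->
  mu.-integrable [set: T] (EFin \o (fun x => f x * g x)).
Proof.
move=> [mf fi] [mg gi].
apply: (@le_integrable _ _ _ _ _ measurableT _
    (EFin \o (fun x => f x ^+ 2 + g x ^+ 2))).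
- by apply/measurable_EFinP; exact: measurable_funM.
- move=> x _ /=; rewrite lee_fin [leRHS]ger0_norm ?addr_ge0 ?sqr_ge0//.
  by rewrite ler_norml; apply/andP; have := sqr_ge0 (f x - g x);
    have := sqr_ge0 (f x + g x); rewrite sqrrB sqrrD => ? ?; split; lra.
- exact: (integrableD measurableT fi gi).
Qed.

Lemma innerC f g : inner f g = inner g f.
Proof. by apply: eq_Rintegral => x _; rewrite mulrC. Qed.

Lemma innerDl f g h : sq_integrable f -> sq_integrable g -> sq_integrable h ->
  inner (fun x => f x + g x) h = inner f h + inner g h.
Proof.
move=> sf sg sh; rewrite /inner -RintegralD//; [|exact: integrable_mul..].
by apply: eq_Rintegral => x _; rewrite mulrDl.
Qed.

Lemma innerZl a f h : sq_integrable f -> sq_integrable h ->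
  inner (fun x => a * f x) h = a * inner f h.
Proof.
move=> sf sh; rewrite /inner -RintegralZl//; last exact: integrable_mul.
by apply: eq_Rintegral => x _; rewrite mulrA.
Qed.

Lemma innerBl f g h : sq_integrable f -> sq_integrable g -> sq_integrable h ->
  inner (fun x => f x - g x) h = inner f h - inner g h.
Proof.
move=> sf sg sh; rewrite /inner -RintegralB//; [|exact: integrable_mul..].
by apply: eq_Rintegral => x _; rewrite mulrBl.
Qed.

Lemma inner0l h : inner (fun=> 0) h = 0.
Proof.
rewrite /inner; under eq_Rintegral do rewrite mul0r.
by rewrite Rintegral_cst// mul0r.
Qed.

Lemma inner_suml I (s : seq I) (c : I -> R) (F : I -> T -> R) h :
    (forall i, sq_integrable (F i)) -> sq_integrable h ->
  inner (fun x => \sum_(i <- s) c i * F i x) h = \sum_(i <- s) c i * inner (F i) h.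
Proof.
move=> sF sh; elim: s => [|i s IH].
  by rewrite big_nil -[RHS](inner0l h); congr inner; apply/funext => x; rewrite big_nil.
rewrite big_cons -IH -innerZl// -innerDl//.
- by congr inner; apply/funext => x; rewrite big_cons.
- exact: sq_integrableZ.
- by apply: sq_integrable_sum => k; exact: sq_integrableZ.
Qed.

Lemma inner_sum I J (s : seq I) (t : seq J) (c : I -> R) (e : J -> R)
    (F : I -> T -> R) (G : J -> T -> R) :
    (forall i, sq_integrable (F i)) -> (forall i, sq_integrable (G i)) ->
  inner (fun x => \sum_(i <- s) c i * F i x) (fun x => \sum_(j <- t) e j * G j x) =
  \sum_(i <- s) \sum_(j <- t) c i * e j * inner (F i) (G j).
Proof.
move=> sF sG; rewrite inner_suml//; last first.
  by apply: sq_integrable_sum => j; exact: sq_integrableZ.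
apply: eq_bigr => i _; rewrite innerC inner_suml// mulr_sumr.
by apply: eq_bigr => j _; rewrite innerC mulrA.
Qed.

Lemma inner_ge0 f : 0 <= inner f f.
Proof. by apply: Rintegral_ge0 => x _; rewrite -expr2 sqr_ge0. Qed.

(** A weighted form of the Cauchy-Schwarz inequality: letting c be small makes
    the fixed function cheap and puts the cost on the one tending to 0. *)
Lemma inner_young c f g : 0 < c -> sq_integrable f -> sq_integrable g ->
  `|inner f g| <= c * inner f f + c^-1 * inner g g.
Proof.
move=> c0 sf sg.
(* Both signs e of the inner product are bounded by expanding the norm of
   c f + e g. *)
have pos (e : R) : e ^+ 2 = 1 ->
    0 <= c * inner f f + c^-1 * inner g g + 2 * e * inner f g.
  move=> e1; have su := sq_integrableD (sq_integrableZ c sf) (sq_integrableZ e sg).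
  have := inner_ge0 (fun x => c * f x + e * g x).
  rewrite innerDl ?innerZl//; [|exact: sq_integrableZ..].
  rewrite [inner f _]innerC [inner g _]innerC !innerDl ?innerZl//;
    try exact: sq_integrableZ.
  rewrite (innerC g f) => H.
  have -> : c * inner f f + c^-1 * inner g g + 2 * e * inner f g =
     (c * (c * inner f f + e * inner f g) + e * (c * inner f g + e * inner g g)) / c.
    transitivity (c * inner f f + c^-1 * (e ^+ 2 * inner g g) + 2 * e * inner f g).
      by rewrite e1 mul1r.
    by field; rewrite gt_eqF.
  by rewrite divr_ge0// ltW.
have := pos 1 (expr1n _ _); have := pos (- 1) (sqrr_sign _ 1).
have := mulr_ge0 (ltW c0) (inner_ge0 f).
have ci0 : 0 <= c^-1 by rewrite invr_ge0 ltW.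
have := mulr_ge0 ci0 (inner_ge0 g) => ? ? ? ?.
by rewrite ler_norml; apply/andP; split; lra.
Qed.

Lemma inner_cvg f g (fn gn : nat -> T -> R) :
    sq_integrable f -> sq_integrable g ->
    (forall n, sq_integrable (fn n)) -> (forall n, sq_integrable (gn n)) ->
    (\int[mu]_x (((f x - fn n x) ^+ 2)%:E))%E @[n --> \oo] --> 0%E ->
    (\int[mu]_x (((g x - gn n x) ^+ 2)%:E))%E @[n --> \oo] --> 0%E ->
  inner (fn n) (gn n) @[n --> \oo] --> inner f g.
Proof.
move=> sf sg sfn sgn fnf gng.
pose u n := inner (fun x => f x - fn n x) (fun x => f x - fn n x).
pose v n := inner (fun x => g x - gn n x) (fun x => g x - gn n x).
have cu : u n @[n --> \oo] --> (0 : R).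
  rewrite (_ : (fun n => u n) =
      fine \o (fun n => \int[mu]_x (((f x - fn n x) ^+ 2)%:E))%E).
    exact: (fine_cvg fnf).
  by apply/funext => n; rewrite /u /inner/= /Rintegral; congr fine.
have cv : v n @[n --> \oo] --> (0 : R).
  rewrite (_ : (fun n => v n) =
      fine \o (fun n => \int[mu]_x (((g x - gn n x) ^+ 2)%:E))%E).
    exact: (fine_cvg gng).
  by apply/funext => n; rewrite /v /inner/= /Rintegral; congr fine.
pose S := inner f f + inner g g + 1.
have S0 : 0 < S by rewrite ltr_wpDl// addr_ge0// inner_ge0.
apply/cvgrPdist_le => e e0.
pose c := e / 2 / S; have c0 : 0 < c by rewrite !divr_gt0.
have K0 : 0 < c^-1 + 1 by rewrite addr_gt0// invr_gt0.
have cw : (c^-1 + 1) * (u n + v n) @[n --> \oo] --> (0 : R).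
  rewrite -[X in _ --> X](mulr0 (c^-1 + 1)); apply: cvgMr.
  by rewrite -[X in _ --> X]addr0; exact: cvgD.
move/cvgrPdist_le : cw => /(_ (e / 2)); rewrite divr_gt0// => /(_ isT) cw.
near=> n.
have : `|0 - (c^-1 + 1) * (u n + v n)| <= e / 2 by near: n; exact: cw.
rewrite sub0r normrN ger0_norm; last first.
  by apply: mulr_ge0; [exact: ltW|apply: addr_ge0; exact: inner_ge0].
move=> Hn.
have sfd := sq_integrableB sf (sfn n); have sgd := sq_integrableB sg (sgn n).
have -> : inner f g - inner (fn n) (gn n) =
    inner g (fun x => f x - fn n x) + inner f (fun x => g x - gn n x)
    - inner (fun x => f x - fn n x) (fun x => g x - gn n x).
  rewrite (innerC g) (innerC f (fun x => g x - gn n x)) !innerBl//.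
  rewrite !(innerC _ (fun x => g x - gn n x)) !innerBl//.
  rewrite (innerC g f) (innerC (gn n) f) (innerC g (fn n)).
  by rewrite (innerC (gn n) (fn n)); ring.
have H1 := inner_young c0 sg sfd; have H2 := inner_young c0 sf sgd.
have H3 := inner_young ltr01 sfd sgd.
apply: le_trans (ler_normB _ _) _.
apply: le_trans (lerD (ler_normD _ _) (lexx _)) _.
have cS : c * (inner f f + inner g g) <= e / 2.
  by rewrite /c -[leRHS](mulfVK (lt0r_neq0 S0)) ler_wpM2l ?(ltW c0)// lerDl.
rewrite -/(u n) -/(v n) invr1 !mul1r in H1 H2 H3.
have [u0 v0] : 0 <= u n /\ 0 <= v n by split; exact: inner_ge0.
have u1 : 0 <= c^-1 * u n by rewrite mulr_ge0// invr_ge0 ltW.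
have v1 : 0 <= c^-1 * v n by rewrite mulr_ge0// invr_ge0 ltW.
move: Hn; rewrite mulrDl mul1r mulrDr => Hn.
move: cS; rewrite mulrDr => cS; lra.
Unshelve. all: by end_near. Qed.

End SquareIntegrable.

(** * Covariance and independence *)

Section CovarianceInner.
Context d (T : measurableType d) (R : realType) (P : probability T R).
Implicit Types X Y : T -> R.

Lemma sq_integrable_cst (c : R) : sq_integrable P (fun=> c).
Proof. by split => //; exact: finite_measure_integrable_cst. Qed.

Lemma Lfun1_mul X Y : sq_integrable P X -> sq_integrable P Y ->
  (fun w => X w * Y w) \in Lfun P 1.
Proof. by move=> sX sY; apply/Lfun1_integrable; exact: integrable_mul. Qed.

Lemma Lfun1_sq_integrable X : sq_integrable P X -> X \in Lfun P 1.
Proof.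
move=> sX; have := Lfun1_mul sX (sq_integrable_cst 1).
by under eq_fun do rewrite mulr1.
Qed.

(** Covariances are used instead of second moments because the centring cancels
    the means of the increments. *)
Definition cov X Y : R := fine (covariance P X Y).

Lemma covE X Y : sq_integrable P X -> sq_integrable P Y ->
  cov X Y = inner P X Y - inner P X (cst 1) * inner P Y (cst 1).
Proof.
move=> sX sY; rewrite /cov.
have lX := Lfun1_sq_integrable sX; have lY := Lfun1_sq_integrable sY.
have lXY : (X * Y)%R \in Lfun P 1 by exact: Lfun1_mul.
rewrite covarianceE// fineB ?fin_numM ?expectation_fin_num//.
rewrite fineM ?expectation_fin_num//.
rewrite unlock /inner /Rintegral /cst.
by congr (fine _ - fine _ * fine _); apply: eq_integral => w _; rewrite mulr1.
Qed.

Lemma covC X Y : sq_integrable P X -> sq_integrable P Y -> cov X Y = cov Y X.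
Proof. by move=> sX sY; rewrite !covE// innerC mulrC. Qed.

Lemma cov_sum I J (s : seq I) (t : seq J) (c : I -> R) (e : J -> R)
    (F : I -> T -> R) (G : J -> T -> R) :
    (forall i, sq_integrable P (F i)) -> (forall j, sq_integrable P (G j)) ->
  cov (fun w => \sum_(i <- s) c i * F i w) (fun w => \sum_(j <- t) e j * G j w) =
  \sum_(i <- s) \sum_(j <- t) c i * e j * cov (F i) (G j).
Proof.
move=> sF sG; have s1 := sq_integrable_cst 1.
have sFs : sq_integrable P (fun w => \sum_(i <- s) c i * F i w).
  by apply: sq_integrable_sum => i; exact: sq_integrableZ.
have sGs : sq_integrable P (fun w => \sum_(j <- t) e j * G j w).
  by apply: sq_integrable_sum => i; exact: sq_integrableZ.
rewrite covE// inner_sum// !inner_suml//.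
rewrite mulr_suml -sumrB; apply: eq_bigr => i _.
rewrite mulr_sumr -sumrB; apply: eq_bigr => j _.
by rewrite covE//; ring.
Qed.

Lemma cov_cvg X Y (Xn Yn : nat -> T -> R) :
    sq_integrable P X -> sq_integrable P Y ->
    (forall n, sq_integrable P (Xn n)) -> (forall n, sq_integrable P (Yn n)) ->
    (\int[P]_w (((X w - Xn n w) ^+ 2)%:E))%E @[n --> \oo] --> 0%E ->
    (\int[P]_w (((Y w - Yn n w) ^+ 2)%:E))%E @[n --> \oo] --> 0%E ->
  cov (Xn n) (Yn n) @[n --> \oo] --> cov X Y.
Proof.
move=> sX sY sXn sYn cX cY; have s1 := sq_integrable_cst 1.
have c1 : (\int[P]_w (((1 - 1 : R) ^+ 2)%:E))%E @[n --> \oo] --> 0%E.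
  rewrite (_ : (fun=> _) = fun=> 0%E); first exact: cvg_cst.
  by apply/funext => n; rewrite subrr expr0n/= integral0.
rewrite covE//; under eq_fun do rewrite covE//.
apply: cvgB; first exact: inner_cvg.
by apply: cvgM; exact: (inner_cvg _ _ _ (fun=> s1) _ c1).
Qed.

End CovarianceInner.

Section Independence.
Context d (T : measurableType d) (R : realType) (P : probability T R).

Definition independent2 (X Y : T -> R) :=
  forall A B : set R, measurable A -> measurable B ->
  P ((X @^-1` A) `&` (Y @^-1` B)) = (P (X @^-1` A) * P (Y @^-1` B))%E.

Variables X Y : {RV P >-> R}.
Hypothesis XY : independent2 X Y.

Let Z w : R * R := (X w, Y w).
Let mZ : measurable_fun [set: T] Z.
Proof. by apply/measurable_fun_pair; exact: measurable_funPT. Qed.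
Let mZ_mixin := isMeasurableFun.Build _ _ _ _ _ mZ.
Let mZ_pack : {mfun T >-> (R * R)%type} := HB.pack Z mZ_mixin.

Lemma joint_distribution (A : set (R * R)) : measurable A ->
  (distribution P X \x distribution P Y)%E A = distribution P mZ_pack A.
Proof.
apply: product_measure_unique => B C mB mC.
exact: XY.
Qed.

Lemma integral_joint (f : R * R -> \bar R) :
  (\int[distribution P X \x distribution P Y]_z f z =
   \int[distribution P mZ_pack]_z f z)%E.
Proof.
by apply: eq_measure_integral => A mA _; exact: joint_distribution.
Qed.

(** By Tonelli for the product of the two laws, the square of X + y is
    integrable for at least one constant y. *)
Lemma independent_sq_integrable :
  sq_integrable P (fun w => X w + Y w) -> sq_integrable P X.
Proof.
move=> [mXY iXY].
pose f (z : R * R) := ((z.1 + z.2) ^+ 2)%:E.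
have mf : measurable_fun [set: R * R] f.
  by apply/measurable_EFinP; apply: measurable_funX; apply: measurable_funD.
have f0 z : (0 <= f z)%E by rewrite lee_fin sqr_ge0.
have : (\int[distribution P X \x distribution P Y]_z f z < +oo)%E.
  rewrite integral_joint ge0_integral_distribution//.
  by have := integrable_lty measurableT iXY; congr (_ < _)%E; apply: eq_integral.
rewrite (fubini_tonelli2 f mf f0).
have [[y fy]|nfy] := pselect (exists y, (fubini_G (distribution P X) f y < +oo)%E).
  move=> _; move: fy; rewrite /fubini_G ge0_integral_distribution//; last first.
    by apply: (measurableT_comp mf); exact: measurable_pair2.
  move=> fy.
  have sXy : sq_integrable P (fun w => X w + y).
    apply: sq_integrableP; first by apply: measurable_funD.
    by [].
  have := sq_integrableB sXy (sq_integrable_cst P y).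
  by under eq_fun do rewrite addrK.
rewrite (eq_integral (cst +oo%E)); last first.
  move=> y _; apply/eqP; rewrite -leye_eq leNgt; apply/negP => fy.
  by apply: nfy; exists y.
by rewrite integral_cst// [X in (_ * X)%E]probability_setT mule1 ltxx.
Qed.

Lemma independent_cov : sq_integrable P X -> sq_integrable P Y ->
  cov P X Y = 0.
Proof.
move=> sX sY; rewrite covE//.
pose f (z : R * R) := (z.1 * z.2)%:E.
have mf : measurable_fun [set: R * R] f.
  by apply/measurable_EFinP; apply: measurable_funM.
have if1 : P.-integrable [set: T] (f \o mZ_pack) by exact: integrable_mul sX sY.
have intf : (distribution P X \x distribution P Y)%E.-integrable [set: R * R] f.
  apply/integrableP; split => //.
  rewrite integral_joint ge0_integral_distribution//; last exact: measurableT_comp.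
  by case/integrableP : if1.
have lX := Lfun1_sq_integrable sX; have lY := Lfun1_sq_integrable sY.
have iX := (Lfun1_integrable _ _).1 lX; have iY := (Lfun1_integrable _ _).1 lY.
have E : (\int[P]_w ((X w * Y w)%:E) =
    \int[P]_w ((X w)%:E) * \int[P]_w ((Y w)%:E))%E.
  transitivity (\int[distribution P mZ_pack]_z f z)%E.
    by rewrite integral_distribution.
  rewrite -integral_joint -(integral12_prod_meas1 intf).
  have EY : (\int[distribution P Y]_y (y%:E) = \int[P]_w ((Y w)%:E))%E.
    by rewrite integral_distribution//; exact/measurable_EFinP.
  have EX : (\int[distribution P X]_y (y%:E) = \int[P]_w ((X w)%:E))%E.
    by rewrite integral_distribution//; exact/measurable_EFinP.
  have idY : (distribution P Y).-integrable [set: R] EFin.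
    by apply: integrable_pushforward => //; exact/measurable_EFinP.
  have idX : (distribution P X).-integrable [set: R] EFin.
    by apply: integrable_pushforward => //; exact/measurable_EFinP.
  have fY : (\int[P]_w ((Y w)%:E))%E \is a fin_num by exact: integrable_fin_num.
  transitivity (\int[distribution P X]_x (x%:E * \int[P]_w ((Y w)%:E)))%E.
    by apply: eq_integral => x _; rewrite /fubini_F -EY -integralZl//.
  rewrite -(fineK fY).
  by rewrite integralZr// EX.
rewrite /inner /Rintegral E fineM; [|exact: integrable_fin_num..].
apply/eqP; rewrite subr_eq0; apply/eqP.
by congr (fine _ * fine _); apply: eq_integral => w _; rewrite /= mulr1.
Qed.

End Independence.

Section SameLaw.
Context d (T : measurableType d) (R : realType) (P : probability T R).

(** Nonnegative test functions suffice: the mean is recovered from the positive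
    and negative parts of the identity. *)
Lemma eq_integral_comp_cov (X X' : T -> R) :
    sq_integrable P X -> measurable_fun [set: T] X' ->
    (forall f : R -> \bar R, measurable_fun [set: R] f ->
      (forall y, (0 <= f y)%E) ->
      (\int[P]_w f (X w) = \int[P]_w f (X' w))%E) ->
  sq_integrable P X' /\ cov P X X = cov P X' X'.
Proof.
move=> sX mX' XX'.
have msq : measurable_fun [set: R] (fun y : R => (y ^+ 2)%:E).
  by apply/measurable_EFinP; exact: measurable_funX.
have sqE : (\int[P]_w ((X w ^+ 2)%:E) = \int[P]_w ((X' w ^+ 2)%:E))%E.
  by apply: (XX' _ msq) => y; rewrite lee_fin sqr_ge0.
have sX' : sq_integrable P X'.
  by apply: sq_integrableP => //; rewrite -sqE; case: sX => _; exact: integrable_lty.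
have mean (V : T -> R) : inner P V (cst 1) = fine (\int[P]_w ((V w)%:E))%E.
  rewrite /inner /Rintegral; congr fine.
  by apply: eq_integral => w _; rewrite /= mulr1.
have mid : measurable_fun [set: R] (EFin : R -> \bar R) by exact/measurable_EFinP.
have meanE : (\int[P]_w ((X w)%:E) = \int[P]_w ((X' w)%:E))%E.
  rewrite integralE [RHS]integralE; congr (_ - _)%E.
    transitivity (\int[P]_w (funepos EFin (X w)))%E.
      by apply: eq_integral => w _; rewrite !funeposE.
    rewrite XX'//; first by apply: eq_integral => w _; rewrite !funeposE.
    exact: measurable_funepos.
  transitivity (\int[P]_w (funeneg EFin (X w)))%E.
    by apply: eq_integral => w _; rewrite !funenegE.
  rewrite XX'//; first by apply: eq_integral => w _; rewrite !funenegE.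
  exact: measurable_funeneg.
split => //; rewrite !covE// !mean meanE; congr (_ - _); rewrite /inner /Rintegral.
under eq_integral do rewrite -expr2; under [in RHS]eq_integral do rewrite -expr2.
by rewrite sqE.
Qed.

Lemma same_law_cov (X X' : {RV P >-> R}) :
    (forall B : set R, measurable B -> P (X @^-1` B) = P (X' @^-1` B)) ->
  sq_integrable P X -> sq_integrable P X' /\ cov P X X = cov P X' X'.
Proof.
move=> XX' sX; apply: eq_integral_comp_cov => // f mf f0.
rewrite -[LHS](ge0_integral_distribution X mf f0).
rewrite -[RHS](ge0_integral_distribution X' mf f0).
by apply: eq_measure_integral => B mB _; exact: XX'.
Qed.

Lemma ae_eq_cov (X X' : T -> R) :
    sq_integrable P X -> measurable_fun [set: T] X' ->
    {ae P, forall w, X w = X' w} ->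
  sq_integrable P X' /\ cov P X X = cov P X' X'.
Proof.
move=> sX mX' XX'; have [mX _] := sX.
apply: eq_integral_comp_cov => // f mf _; apply: ae_eq_integral => //.
- exact: measurableT_comp mf mX.
- exact: measurableT_comp mf mX'.
- by apply: filterS XX' => w -> _.
Qed.

Lemma covB (A B C D : T -> R) : sq_integrable P A -> sq_integrable P B ->
    sq_integrable P C -> sq_integrable P D ->
  cov P (fun w => A w - B w) (fun w => C w - D w) =
  cov P A C - cov P A D - cov P B C + cov P B D.
Proof.
move=> sA sB sC sD; have s1 := sq_integrable_cst P 1.
rewrite !covE//; try exact: sq_integrableB.
have sCD : sq_integrable P (fun w => C w - D w) by exact: sq_integrableB.
rewrite !innerBl// !(innerC _ _ (fun w => C w - D w)) !innerBl//.
by rewrite (innerC _ C A) (innerC _ C B) (innerC _ D A) (innerC _ D B); ring.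
Qed.

Lemma covD (A B C D : T -> R) : sq_integrable P A -> sq_integrable P B ->
    sq_integrable P C -> sq_integrable P D ->
  cov P (fun w => A w + B w) (fun w => C w + D w) =
  cov P A C + cov P A D + cov P B C + cov P B D.
Proof.
move=> sA sB sC sD; have s1 := sq_integrable_cst P 1.
rewrite !covE//; try exact: sq_integrableD.
have sCD : sq_integrable P (fun w => C w + D w) by exact: sq_integrableD.
rewrite !innerDl// !(innerC _ _ (fun w => C w + D w)) !innerDl//.
by rewrite (innerC _ C A) (innerC _ C B) (innerC _ D A) (innerC _ D B); ring.
Qed.

Lemma cov_ge0 (X : T -> R) : 0 <= cov P X X.
Proof. by rewrite /cov fine_ge0//; exact: variance_ge0. Qed.

End SameLaw.

(** * Variance of the increments of the driving process *)

(** Additivity and nonnegativity give monotonicity; comparing n t with the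
    integers around it bounds n |v t - v 1 t| independently of n. *)
Lemma additive_ge0_linear (R : realType) (v : R -> R) :
    (forall t, 0 <= t -> 0 <= v t) ->
    (forall s t, 0 <= s -> 0 <= t -> v (s + t) = v s + v t) ->
  forall t, 0 <= t -> v t = v 1 * t.
Proof.
move=> v0 vD t t0.
have v00 : v 0 = 0 by have := vD 0 0 (lexx _) (lexx _); rewrite addr0; lra.
have vn n s : 0 <= s -> v (n%:R * s) = n%:R * v s.
  move=> s0; elim: n => [|n IH]; first by rewrite !mul0r.
  by rewrite -natr1 !mulrDl !mul1r vD ?IH// mulr_ge0.
have vle s u : 0 <= s -> s <= u -> v s <= v u.
  move=> s0 su; rewrite -(subrK s u) addrC vD// ?subr_ge0//.
  by rewrite lerDl v0// subr_ge0.
have bound n : n%:R * `|v t - v 1 * t| <= v 1.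
  have nt0 : 0 <= n%:R * t by rewrite mulr_ge0.
  have [k0 k1] := andP (truncn_itv nt0); set k := Num.truncn _ in k0 k1.
  have H1 := vle _ _ (ler0n _ _) k0.
  have H2 := vle _ _ nt0 (ltW k1).
  rewrite !(vn n)// -[k%:R]mulr1 (vn k)// in H1.
  rewrite (vn n)// -[k.+1%:R]mulr1 (vn k.+1)// -natr1 in H2.
  have v1 := v0 _ ler01.
  rewrite -{1}[n%:R]ger0_norm ?ler0n// -normrM mulrBr mulrCA.
  have K0 := ler_wpM2l v1 k0; have K1 := ler_wpM2l v1 (ltW k1).
  rewrite -natr1 in K1.
  by rewrite ler_norml; apply/andP; split; lra.
apply/eqP; rewrite -subr_eq0 -normr_eq0 eq_le normr_ge0 andbT leNgt.
apply/negP => e0.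
have := bound (Num.Def.archi_bound (v 1 / `|v t - v 1 * t|)).
rewrite -ler_pdivlMr// leNgt archi_boundP// divr_ge0// ?v0//.
Qed.

Section LevyIncrements.
Context d (T : measurableType d) (R : realType) (P : probability T R).
Variables (L : R -> {RV P >-> R}) (sigma : R).
Hypotheses (hL : levy_process L) (hmean : ('E_P[L 1%R] = 0)%E)
  (hvar : ('E_P[fun w => (L 1 w ^+ 2)%R] = (sigma ^+ 2)%:E)%E).

Definition incr (s t : R) : {RV P >-> R} := L t \- L s.

Lemma incr_adjacent_independent s t u : s <= t -> t <= u ->
  independent2 P (incr s t) (incr t u).
Proof.
move=> st tu A B mA mB; case: hL => _ ind _ _ _.
pose tm k := if k is k'.+1 then (if k' is _.+1 then u else t) else s.
have tm_homo : {homo tm : i j / (i <= j)%N >-> i <= j}.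
  by move=> [|[|i]] [|[|j]]//= _; rewrite ?(le_trans st).
pose Bs (i : 'I_2) := if i == ord0 then A else B.
have mBs i : measurable (Bs i) by rewrite /Bs; case: ifP.
have := ind 2%N tm tm_homo Bs mBs.
rewrite big_ord_recl big_ord1 /Bs/= => <-; congr (P _).
apply/seteqP; split=> [w [Aw Bw] i _|w Hw].
  have [->|i0] := eqVneq i ord0; first exact: Aw.
  have -> : i = lift ord0 ord0.
    by apply/val_inj; case: i i0 => -[|[|]]//.
  exact: Bw.
by split; [exact: (Hw ord0)|exact: (Hw (lift ord0 ord0))].
Qed.

Lemma incr_shift s t h : s <= t -> sq_integrable P (incr s t) ->
  sq_integrable P (incr (s + h) (t + h)) /\
  cov P (incr s t) (incr s t) = cov P (incr (s + h) (t + h)) (incr (s + h) (t + h)).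
Proof.
move=> st; apply: same_law_cov => B mB.
by case: hL => _ _ stat _ _; apply/esym/stat.
Qed.

Lemma incr01 : sq_integrable P (incr 0 1) /\
  cov P (incr 0 1) (incr 0 1) = sigma ^+ 2.
Proof.
have sL1 : sq_integrable P (L 1).
  by apply: sq_integrableP => //; move: hvar; rewrite unlock => ->; rewrite ltry.
have [//||sI covI] := @ae_eq_cov _ _ _ P _ (incr 0 1) sL1.
  by case: hL => L0 _ _ _ _; apply: filterS L0 => w /= ->; rewrite subr0.
split => //; rewrite -covI covE// /inner.
move: hvar hmean; rewrite unlock => vE mE.
rewrite (_ : (\int[P]_w (L 1 w * cst 1 w))%R = 0) ?mulr0 ?subr0; last first.
  rewrite -[RHS]/(fine 0) -mE /Rintegral; congr fine.
  by apply: eq_integral => w _; rewrite /= mulr1.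
rewrite -[RHS]/(fine (sigma ^+ 2)%:E) -vE /Rintegral; congr fine.
Qed.

Lemma incrD s t u w : incr s u w = incr s t w + incr t u w.
Proof. by rewrite /incr /=; ring. Qed.

Lemma incr_natural n : sq_integrable P (incr 0 n%:R).
Proof.
elim: n => [|n IH].
  rewrite (_ : (incr 0 0 : T -> R) = fun=> 0); first exact: sq_integrable0.
  by apply/funext => w; rewrite /incr/= subrr.
rewrite (_ : (incr 0 n.+1%:R : T -> R) =
    fun w => incr 0 n%:R w + incr n%:R n.+1%:R w); last first.
  by apply/funext => w; exact: incrD.
apply: sq_integrableD => //.
have [+ _] := incr_shift n%:R ler01 incr01.1.
by rewrite add0r -nat1r.
Qed.

(** Only L_1 is assumed to have a variance.  For n >= t, the increment over
    [0, n] is a sum of n copies of the unit increment, and it splits at t into two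
    independent parts, each of which must then be square integrable. *)
Lemma sq_integrable_incr0 t : 0 <= t -> sq_integrable P (incr 0 t).
Proof.
move=> t0; have tn := ltW (archi_boundP t0); set n := Num.Def.archi_bound t in tn.
apply: (independent_sq_integrable (incr_adjacent_independent t0 tn)).
have := incr_natural n; congr sq_integrable.
by apply/funext => w; exact: incrD.
Qed.

Lemma sq_integrable_incr s t : sq_integrable P (incr s t).
Proof.
wlog st : s t / s <= t => [H|].
  have [/H//|/ltW/H sts] := leP s t.
  have := sq_integrableZ (- 1) sts; congr sq_integrable.
  by apply/funext => w; rewrite mulN1r /incr/= opprB.
have ts0 : 0 <= t - s by rewrite subr_ge0.
have [+ _] := incr_shift s ts0 (sq_integrable_incr0 ts0).
by rewrite add0r subrK.
Qed.

Lemma var_incr0 t : 0 <= t -> cov P (incr 0 t) (incr 0 t) = sigma ^+ 2 * t.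
Proof.
move=> t0; rewrite -[in RHS]incr01.2.
apply: (additive_ge0_linear (v := fun t => cov P (incr 0 t) (incr 0 t))) => //.
  by move=> ? _; exact: cov_ge0.
move=> {t t0} s t s0 t0.
have sst : s <= s + t by rewrite lerDl.
have sA := sq_integrable_incr 0 s; have sB := sq_integrable_incr s (s + t).
have AB := independent_cov (incr_adjacent_independent s0 sst) sA sB.
have BE : cov P (incr s (s + t)) (incr s (s + t)) = cov P (incr 0 t) (incr 0 t).
  have [_ ->] := incr_shift s t0 (sq_integrable_incr0 t0).
  by rewrite add0r addrC.
have -> : (incr 0 (s + t) : T -> R) = fun w => incr 0 s w + incr s (s + t) w.
  by apply/funext => w; exact: incrD.
by rewrite covD// AB (covC sB sA) AB BE; ring.
Qed.

(** Polarization of the variances sigma^2 |y - x|.  The right-hand side is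
    sigma^2 times the length of the overlap of the two intervals. *)
Lemma cov_incr s t u v : cov P (incr s t) (incr u v) =
  sigma ^+ 2 * ((`|t - u| + `|s - v| - `|t - v| - `|s - u|) / 2).
Proof.
pose K x y := cov P (incr 0 x) (incr 0 y).
have sI := sq_integrable_incr.
have KC x y : K x y = K y x by exact: covC.
have incrE x y : (incr x y : T -> R) = fun w => incr 0 y w - incr 0 x w.
  by apply/funext => w; rewrite /incr/=; ring.
have KE x y : K y y + K x x - 2 * K x y = sigma ^+ 2 * `|y - x|.
  wlog xy : x y / x <= y => [H|].
    by have [/H//|/ltW/H] := leP x y; rewrite distrC KC => <-; ring.
  have yx0 : 0 <= y - x by rewrite subr_ge0.
  rewrite ger0_norm// -(var_incr0 yx0).
  have [_ ->] := incr_shift x yx0 (sq_integrable_incr0 yx0).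
  by rewrite add0r subrK incrE covB// -!/(K _ _) (KC y x); ring.
rewrite (incrE s t) (incrE u v) covB// -!/(K _ _).
have := KE t u; have := KE s v; have := KE t v; have := KE s u.
rewrite !(distrC u) !(distrC v).
set a := `|_|; set b := `|_|; set c := `|_|; set e := `|_|.
set S := sigma ^+ 2 => H1 H2 H3 H4.
have -> : S * ((e + c - b - a) / 2) = (S * e + S * c - S * b - S * a) / 2.
  by field.
by rewrite -H1 -H2 -H3 -H4; field.
Qed.

End LevyIncrements.

(** * The isometry *)

Section StepFunctions.
Context {R : realType}.
Local Notation leb := (@lebesgue_measure R).

Lemma sq_integrable_indic_itv (s t : R) :
  sq_integrable leb (\1_(`]s, t]%classic) : R -> R).
Proof.
split; first exact: measurable_indic.
have := @integrable_indic_itv R s t false false.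
apply: eq_integrable => // x _.
by rewrite /= /indic; case: (x \in _); rewrite expr2 ?mulr1 ?mulr0.
Qed.

(** Written in the form that polarization gives in cov_incr, for the two to match
    term by term. *)
Lemma inner_indic_itv (s t u v : R) : s <= t -> u <= v ->
  inner leb (\1_(`]s, t]%classic)) (\1_(`]u, v]%classic)) =
  (`|t - u| + `|s - v| - `|t - v| - `|s - u|) / 2.
Proof.
move=> st uv.
have -> : inner leb (\1_(`]s, t]%classic)) (\1_(`]u, v]%classic)) =
    fine (leb (`]Num.max s u, Num.min t v]%classic : set R)).
  rewrite /inner /Rintegral; congr fine.
  rewrite -[X in _ = leb X]setIT -integral_indic//.
  apply: eq_integral => x _; rewrite /indic -natrM mulnb -in_setI; congr (_%:E).
  congr (_ _); congr (x \in _).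
  apply/seteqP; split=> y /=; rewrite !in_itv/= gt_max le_min.
    by move=> [/andP[-> ->] /andP[-> ->]].
  by move=> /andP[/andP[-> ->] /andP[-> ->]].
rewrite lebesgue_measure_itv/= lte_fin.
have -> : fine (if Num.max s u < Num.min t v then
   ((Num.min t v)%:E + - (Num.max s u)%:E)%E else 0%E) =
   if Num.max s u < Num.min t v then Num.min t v - Num.max s u else 0.
  by case: ifP.
case: (lerP s u) => ?; case: (lerP t v) => ?; case: ltP => ?;
 case: (ger0P (t - u)) => ?; case: (ger0P (s - v)) => ?;
 case: (ger0P (t - v)) => ?; case: (ger0P (s - u)) => ?; lra.
Qed.

Lemma sq_integrable_step_fun (s : steps) : sq_integrable leb (step_fun s).
Proof.
by apply: sq_integrable_sum => i; apply: sq_integrableZ; exact: sq_integrable_indic_itv.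
Qed.

Context d (T : measurableType d) (P : probability T R).
Variables (L : R -> {RV P >-> R}) (sigma : R).
Hypotheses (hL : levy_process L) (hmean : ('E_P[L 1%R] = 0)%E)
  (hvar : ('E_P[fun w => (L 1 w ^+ 2)%R] = (sigma ^+ 2)%:E)%E).

Lemma sq_integrable_step_integral (s : steps) : sq_integrable P (step_integral L s).
Proof.
apply: sq_integrable_sum => i; apply: sq_integrableZ.
exact: (sq_integrable_incr hL hmean hvar).
Qed.

(** The isometry on step functions, by bilinearity. *)
Lemma cov_step_integral (s s' : steps) : wf_steps s -> wf_steps s' ->
  cov P (step_integral L s) (step_integral L s') =
  sigma ^+ 2 * inner leb (step_fun s) (step_fun s').
Proof.
move=> /allP ws /allP ws'.
have sI := sq_integrable_incr hL hmean hvar.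
transitivity (cov P (fun w => \sum_(i <- s) i.1 * incr L i.2.1 i.2.2 w)
  (fun w => \sum_(i <- s') i.1 * incr L i.2.1 i.2.2 w)) => //.
rewrite (@cov_sum _ _ _ P _ _ s s' (fun i => i.1) (fun i => i.1)
  (fun i => incr L i.2.1 i.2.2) (fun i => incr L i.2.1 i.2.2))//.
rewrite (@inner_sum _ _ _ leb _ _ s s' (fun i => i.1) (fun i => i.1)
  (fun i => \1_(`]i.2.1, i.2.2]%classic)) (fun i => \1_(`]i.2.1, i.2.2]%classic)));
  [|by move=> i; exact: sq_integrable_indic_itv..].
rewrite mulr_sumr; apply: eq_big_seq => i /ws wi.
rewrite mulr_sumr; apply: eq_big_seq => j /ws' wj.
by rewrite (cov_incr hL hmean hvar) inner_indic_itv//; ring.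
Qed.

Lemma levy_integral_sq_integrable (f : R -> R) (X : {RV P >-> R}) :
    measurable_fun [set: R] f -> is_levy_integral L f X ->
  sq_integrable leb f /\ sq_integrable P X.
Proof.
move=> mf [s [_ cf cX]].
have fin0 (u : nat -> \bar R) : u @ \oo --> 0%E -> exists n, (u n < +oo)%E.
  move=> /fine_cvgP[[N _ uN] _]; exists N.
  by have := uN N (leqnn N); rewrite /= fin_numElt => /andP[].
have approx d' (T' : measurableType d') (mu : {measure set T' -> \bar R})
    (h k : T' -> R) : measurable_fun [set: T'] h -> sq_integrable mu k ->
    (\int[mu]_x (((h x - k x) ^+ 2)%:E) < +oo)%E -> sq_integrable mu h.
  move=> mh sk hk; have [mk _] := sk.
  have shk : sq_integrable mu (fun x => h x - k x).
    by apply: sq_integrableP => //; exact: measurable_funB.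
  have := sq_integrableD shk sk; congr sq_integrable.
  by apply/funext => x; rewrite subrK.
split.
  have [n] := fin0 _ cf; apply: approx => //; exact: sq_integrable_step_fun.
have [n] := fin0 _ cX; rewrite unlock; apply: approx => //.
exact: sq_integrable_step_integral.
Qed.

(** The isometry passes to the limit because both sides are continuous for mean
    square convergence. *)
Lemma cov_levy_integral (f g : R -> R) (X Y : {RV P >-> R}) :
    measurable_fun [set: R] f -> measurable_fun [set: R] g ->
    is_levy_integral L f X -> is_levy_integral L g Y ->
  cov P X Y = sigma ^+ 2 * inner leb f g.
Proof.
move=> mf mg iX iY.
have [sf sX] := levy_integral_sq_integrable mf iX.
have [sg sY] := levy_integral_sq_integrable mg iY.
move: iX iY => [s [ws cf cX]] [s' [ws' cg cY]].
rewrite unlock in cX cY.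
have H1 := cov_cvg sX sY (fun n => sq_integrable_step_integral (s n))
  (fun n => sq_integrable_step_integral (s' n)) cX cY.
have H2 := inner_cvg sf sg (fun n => sq_integrable_step_fun (s n))
  (fun n => sq_integrable_step_fun (s' n)) cf cg.
have H3 : sigma ^+ 2 * inner leb (step_fun (s n)) (step_fun (s' n)) @[n --> \oo]
    --> (sigma ^+ 2 * inner leb f g : R) by exact: cvgMr.
have covE' : (fun n => cov P (step_integral L (s n)) (step_integral L (s' n))) =
    fun n => sigma ^+ 2 * inner leb (step_fun (s n)) (step_fun (s' n)).
  by apply/funext => n; exact: cov_step_integral.
rewrite covE' in H1.
exact: (cvg_unique (@norm_hausdorff _ _) H1 H3).
Qed.

End StepFunctions.

(** * The autocovariance at lag p - 1 *)

Lemma is_derive_poly_act (R : realType) (b : {poly R}) (F F' : nat -> R -> R) (t : R) :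
    (forall i, is_derive t (1 : R) (F i) (F' i t)) ->
  is_derive t (1 : R) (fun t => poly_act b (F ^~ t)) (poly_act b (F' ^~ t)).
Proof.
move=> dF; rewrite /poly_act.
elim: (size b) => [|n IH].
  rewrite big_ord0 (_ : (fun t => _) = cst 0); first exact: is_derive_cst.
  by apply/funext => x; rewrite big_ord0.
rewrite big_ord_recr (_ : (fun t => _) =
    fun t => \sum_(i < n) b`_i * F i t + b`_n * F n t).
  by apply: is_derive_add => //; exact: is_derive_scal.
by apply/funext => x; rewrite big_ord_recr.
Qed.

(** The k-th derivative of g at 0 is the sum of the b_i y_(k+i) (0), where only
    the term k + i = p - 1 survives as long as k < p - q.  As b has degree q, this
    term first appears at k = p - q - 1, with coefficient b_q = 1. *)
Lemma kernel_flat (R : realType) (p q : nat) (b : {poly R}) (y : nat -> R -> R) :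
    (q < p)%N -> b`_q = 1 -> (forall j, (q < j)%N -> b`_j = 0) ->
    (forall k (t : R), is_derive t (1 : R) (y k) (y k.+1 t)) ->
    (forall k, (k < p)%N -> y k 0 = (k == p.-1)%:R) ->
  let g t := poly_act b (y ^~ t) in
  forall e : R, 0 < e -> exists2 r : R, 0 < r &
    forall t, `|t| < r ->
      `|g t - t ^+ (p - q).-1 / ((p - q).-1)`!%:R| <= e * `|t| ^+ (p - q).-1.
Proof.
move=> qp bq b0 dy y0 g.
have sb : (size b <= q.+1)%N by apply/leq_sizeP => j; exact: b0.
have p0 : (0 < p)%N by exact: leq_ltn_trans qp.
apply: (@flat_expansion _ _ (fun k t => poly_act b (fun i => y (k + i)%N t))).
- move=> k t; exact: (@is_derive_poly_act _ _ (fun i => y (k + i)%N)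
    (fun i => y (k.+1 + i)%N)).
- move=> k kn; rewrite (poly_actE _ sb) big1// => i _.
  have iq : (i <= q)%N by rewrite -ltnS.
  by rewrite y0 ?ltn_eqF ?mulr0//; lia.
- have nqE : ((p - q).-1 + q = p.-1)%N by lia.
  rewrite (poly_actE _ sb) big_ord_recr big1/= => [|i _].
    by rewrite add0r bq mul1r nqE y0 ?eqxx// ltn_predL.
  have iq : (i < q)%N by [].
  by rewrite y0 ?ltn_eqF ?mulr0//; lia.
Qed.

Lemma measurable_carma_kernel (R : realType) (a b : {poly R}) (g : R -> R) (t : R) :
    continuous g -> (forall t, carma_kernel a b t = if 0 < t then g t else 0) ->
  measurable_fun [set: R] (fun u => carma_kernel a b (t - u)).
Proof.
move=> cg kE.
rewrite (_ : (fun u => _) = (fun u => g (t - u) * \1_(`]-oo, t[%classic) u)).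
  apply: measurable_funM; last exact: measurable_indic.
  apply: continuous_measurable_fun => x.
  apply: (@continuous_comp _ _ _ (fun u : R => t - u) g); last exact: cg.
  by apply: cvgB; [exact: cvg_cst|exact: cvg_id].
apply/funext => u; rewrite kE subr_gt0 indicE mem_setE in_itv/=.
by case: (u < t); rewrite ?mulr1 ?mulr0.
Qed.

(** Both sides are bilinear in the coefficients of phi; the isometry is applied
    to each pair of lags. *)
Lemma cov_lag_filter (R : realType) (d : measure_display)
    (T : measurableType d) (P : probability T R)
    (L : R -> {RV P >-> R}) (sigma : R) (phi : {poly R}) (f : R -> R)
    (Y : R -> {RV P >-> R}) (D : R) (m n : int) :
    levy_process L -> ('E_P[L 1%R] = 0)%E ->
    ('E_P[fun w => (L 1 w ^+ 2)%R] = (sigma ^+ 2)%:E)%E ->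
    (forall t, measurable_fun [set: R] (fun u => f (t - u))) ->
    (forall t, is_levy_integral L (fun u => f (t - u)) (Y t)) ->
  cov P (lag_filter phi (sampled Y D) m) (lag_filter phi (sampled Y D) n) =
  sigma ^+ 2 * inner lebesgue_measure
    (fun u => poly_act phi (fun k => f (m%:~R * D - u - k%:R * D)))
    (fun u => poly_act phi (fun k => f (n%:~R * D - u - k%:R * D))).
Proof.
move=> hL hmean hvar mk hY.
pose t (m : int) (k : nat) := (m - k%:Z)%:~R * D.
pose K (m : int) (k : 'I_(size phi)) u := f (t m k - u).
have sq m' k := levy_integral_sq_integrable hL hmean hvar (mk (t m' k)) (hY (t m' k)).
have KE m' : (fun u => poly_act phi (fun k => f (m'%:~R * D - u - k%:R * D)))
    = (fun u => \sum_(k < size phi) phi`_k * K m' k u).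
  apply/funext => u; apply: eq_bigr => k _; congr (_ * f _).
  by rewrite /t intrB; ring.
transitivity (cov P (fun w => \sum_(k < size phi) phi`_k * Y (t m k) w)
  (fun w => \sum_(k < size phi) phi`_k * Y (t n k) w)) => //.
rewrite cov_sum; [|by move=> i; exact: (sq m i).2|by move=> i; exact: (sq n i).2].
rewrite (_ : inner _ _ _ = inner lebesgue_measure
    (fun u => \sum_(k < size phi) phi`_k * K m k u)
    (fun u => \sum_(k < size phi) phi`_k * K n k u)); last first.
  by rewrite -(KE m) -(KE n).
have sK m' i : sq_integrable lebesgue_measure (K m' i).
  exact: (sq m' i).1.
rewrite inner_sum//.
rewrite mulr_sumr; apply: eq_bigr => i _; rewrite mulr_sumr; apply: eq_bigr => k _.
rewrite (cov_levy_integral hL hmean hvar (mk _) (mk _) (hY _) (hY _)).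
by rewrite mulrCA.
Qed.

Theorem corollary3p9 (R : realType) (d : measure_display)
    (T : measurableType d) (P : probability T R)
    (L : R -> {RV P >-> R}) (sigma : R)
    (p q : nat) (a b : {poly R}) (lam : 'I_p -> R[i])
    (Y : R -> {RV P >-> R})
    (hL : levy_process L)
    (hmean : ('E_P[L 1%R] = 0)%E)
    (hvar : ('E_P[fun w => (L 1 w ^+ 2)%R] = (sigma ^+ 2)%:E)%E)
    (hsigma : 0 < sigma ^+ 2)
    (hqp : (q < p)%N)
    (ha : a \is monic) (hsa : size a = p.+1)
    (hb : b`_q = 1) (hb0 : forall j : nat, (q < j)%N -> b`_j = 0)
    (hcoprime : forall z : R[i],
      ~ (root (map_poly (real_complex R) a) z /\
         root (map_poly (real_complex R) b) z))
    (hstable : forall z : R[i],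
      root (map_poly (real_complex R) a) z -> complex.Re z < 0)
    (hlam : map_poly (real_complex R) a = \prod_(j < p) ('X - (lam j)%:P))
    (hY : is_carma a b L Y)
    (j : int) :
  gammaMA P lam Y Delta j (p%:Z - 1) /
      ((-1) ^+ q * (sigma ^+ 2 * Delta ^+ (2 * (p - q) - 1)%N
        / ((2 * (p - q) - 1)`!)%:R))
    @[Delta --> 0^'+] --> (1 : R) /\
  \forall Delta \near 0^'+, gammaMA P lam Y Delta j (p%:Z - 1) != 0.
Proof.
have p0 : (0 < p)%N by exact: leq_ltn_trans hqp.
have [y [dy yrec y0 kE]] := carma_kernelP b ha hsa p0.
have sb : (size b <= p)%N.
  by apply/leq_sizeP => i pi; apply: hb0; exact: leq_trans pi.
pose g t := poly_act b (y ^~ t).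
have {}kE t : carma_kernel a b t = if 0 < t then g t else 0.
  by rewrite kE /g (poly_actE _ sb).
have dg (t : R) : is_derive t (1 : R) g (poly_act b (fun i => y i.+1 t)).
  exact: (@is_derive_poly_act _ _ y (fun i => y i.+1)).
have cg : continuous g.
  by move=> t; exact/differentiable_continuous/derivable1_diffP.
have kill D t : poly_act (ar_poly lam D) (fun k => g (t - k%:R * D)) = 0.
  apply: (@ar_poly_annihilates R p a b lam y D hlam dy _ t) => k {}t.
  by rewrite (@poly_actE _ p.+1) ?hsa.
(* n is the order of vanishing of g at 0. *)
pose n := (p - q).-1.
have exp_g := kernel_flat hqp hb hb0 dy y0.
have nE : (2 * (p - q) - 1 = n.*2.+1)%N by rewrite /n; lia.
pose I D := (\int[lebesgue_measure]_(x in `[0, 1]) (g (D * x - D) * g (D * x)))%R.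
have gammaE D : 0 < D -> gammaMA P lam Y D j (p%:Z - 1) =
    sigma ^+ 2 * (- (ar_poly lam D)`_p * (D * I D)).
  move=> D0.
  rewrite -[LHS]/(cov P (lag_filter (ar_poly lam D) (sampled Y D) (j + (p%:Z - 1)))
    (lag_filter (ar_poly lam D) (sampled Y D) j)).
  rewrite (@cov_lag_filter _ _ _ P L sigma (ar_poly lam D) (carma_kernel a b) Y D
    _ _ hL hmean hvar)//; last first.
    by move=> t; exact: measurable_carma_kernel cg kE.
  congr (_ * _).
  rewrite -(Rintegral_filtered_kernel p0 D0 (size_ar_poly lam D)
    (ar_poly_coef0 lam D) (kill D) cg (j%:~R * D)).
  apply: eq_Rintegral => u _; congr (_ * _); apply: eq_bigr => k _; rewrite kE//.
  have -> : (j + (p%:Z - 1))%:~R = j%:~R + p.-1%:R :> R.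
    by rewrite -{1}(prednK p0) -addn1 PoszD addrK intrD.
  by rewrite mulrDl.
have lim : gammaMA P lam Y Delta j (p%:Z - 1) /
      ((-1) ^+ q * (sigma ^+ 2 * Delta ^+ (2 * (p - q) - 1)%N
        / ((2 * (p - q) - 1)`!)%:R)) @[Delta --> 0^'+] --> (1 : R).
  rewrite nE.
  have cI := rescaled_product_cvg cg exp_g; rewrite -/n in cI.
  have cphi := ar_poly_coef_cvg lam.
  have f0 : (n.*2.+1)`!%:R != 0 :> R by rewrite pnatr_eq0 -lt0n fact_gt0.
  have s0 : (-1) ^+ q != 0 :> R by rewrite signr_eq0.
  have H : (- (ar_poly lam D)`_p * (I D / D ^+ n.*2)) * ((n.*2.+1)`!%:R / (-1) ^+ q)
      @[D --> 0^'+] --> (- (-1) ^+ p * ((-1) ^+ n / (n.*2.+1)`!%:R) *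
        ((n.*2.+1)`!%:R / (-1) ^+ q) : R).
    apply: cvgM; last exact: cvg_cst.
    exact: (cvgM (cvgN cphi) cI).
  have lE : - (-1) ^+ p * ((-1) ^+ n / (n.*2.+1)`!%:R) *
        ((n.*2.+1)`!%:R / (-1) ^+ q) = 1 :> R.
    (* The signs (-1)^(p + 1), (-1)^n and (-1)^q multiply to 1. *)
    have -> : p = (n + q).+1 by rewrite /n; lia.
    rewrite exprS exprD -[RHS](sqrr_sign R n).
    have xzE (x z F : R) : z != 0 -> F != 0 ->
      - (-1 * (x * z)) * (x / F) * (F / z) = x ^+ 2 by move=> ? ?; field; apply/andP.
    exact: xzE.
  rewrite lE in H.
  apply: cvg_trans H; apply: near_eq_cvg; near=> D.
  have D0 : 0 < D by near: D; exact: nbhs_right_gt.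
  have sg0 : sigma != 0 by rewrite -sqrf_eq0 gt_eqF.
  have Dn : D ^+ n.*2 != 0 by rewrite expf_neq0 ?gt_eqF.
  rewrite gammaE// [D ^+ n.*2.+1]exprS; field.
  by rewrite sg0 Dn s0 f0 gt_eqF.
split=> //.
near=> D.
have : gammaMA P lam Y D j (p%:Z - 1) /
      ((-1) ^+ q * (sigma ^+ 2 * D ^+ (2 * (p - q) - 1)%N
        / ((2 * (p - q) - 1)`!)%:R)) != 0.
  by near: D; apply: cvgr_neq0 lim _; exact: oner_neq0.
by apply: contra => /eqP ->; rewrite mul0r.
Unshelve. all: by end_near. Qed.
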